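(* Let $\mathcal{M}=(\mathcal{S},\mathcal{A},\boldsymbol{P},\boldsymbol{r},H)$ be an $H$-MDP (finite-horizon Markov decision process with horizon $H$) with a sampling oracle, and suppose that a state can be sampled from each probability vector $\boldsymbol{P}_{s,a}$ within time $O(1)$. Let $\epsilon,\delta\in(0,1)$. Then there exists an algorithm that runs in time $$O\left[\frac{1}{\epsilon^2}\cdot H^4|\mathcal{S}||\mathcal{A}|\cdot\log\frac{H|\mathcal{S}||\mathcal{A}|}{\delta\cdot\epsilon}\cdot\log\frac{H}{\epsilon}\right]$$ and obtains a policy $\pi:\mathcal{S}\times[H]\to\mathcal{A}$ such that, with probability at least $1-\delta$, $$\forall h\in[H]:\quad \boldsymbol{v}_h^*-\epsilon\boldsymbol{1}\le\boldsymbol{v}_h^\pi\le\boldsymbol{v}_h^*,$$ where $\boldsymbol{v}_h^*$ is the optimal value of $\mathcal{M}$ at stage $h$. Moreover, the number of samples used by the algorithm is $$O\left[\frac{1}{\epsilon^2}\cdot H^3|\mathcal{S}||\mathcal{A}|\cdot\log\frac{H|\mathcal{S}||\mathcal{A}|}{\delta\cdot\epsilon}\cdot\log\frac{H}{\epsilon}\right].$$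
   Context: An $H$-MDP $(\mathcal{S},\mathcal{A},\boldsymbol{P},\boldsymbol{r},H)$ has a finite state space $\mathcal{S}$, finite action space $\mathcal{A}$, stage-independent transition probability vectors $\boldsymbol{P}_{s,a}$ over $\mathcal{S}$ for $(s,a)\in\mathcal{S}\times\mathcal{A}$, known rewards $\boldsymbol{r}\in[0,1]^{\mathcal{S}\times\mathcal{A}}$, and a horizon (positive integer) $H$; $[H]=\{1,\dots,H\}$. The transitions are unknown and accessed only through a sampling oracle: given any $(s,a)$, it returns an independent sample of a state from $\boldsymbol{P}_{s,a}$. A (non-stationary) policy is a map $\pi:\mathcal{S}\times[H]\to\mathcal{A}$. Its value at stage $h$ is the expected cumulative undiscounted reward from stage $h$ to stage $H$: $\boldsymbol{v}^\pi_{H+1}=\boldsymbol{0}$ and $\boldsymbol{v}^\pi_h(s)=\boldsymbol{r}(s,\pi(s,h))+\boldsymbol{P}_{s,\pi(s,h)}^\top\boldsymbol{v}^\pi_{h+1}$. The optimal values are $\boldsymbol{v}^*_{H+1}=\boldsymbol{0}$, $\boldsymbol{v}^*_h(s)=\max_{a\in\mathcal{A}}[\boldsymbol{r}(s,a)+\boldsymbol{P}_{s,a}^\top\boldsymbol{v}^*_{h+1}]$. Vector inequalities are coordinatewise and $\boldsymbol{1}$ is the all-ones vector.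
   Formalization: In the running-time bound each logarithm is read as max(1, log): for H = 1 and ε → 1 the literal bound tends to 0, while choosing a policy takes at least one step. For H ≥ 2 or ε ≤ 1/2 this only changes the constant; the sample bound is literal. *)

(* Defs.v *)
From mathcomp Require Import all_boot all_order all_algebra.
From mathcomp Require Import boolp reals exp.

Set Implicit Arguments.
Unset Strict Implicit.
Unset Printing Implicit Defensive.

Import Order.TTheory GRing.Theory Num.Theory.
Local Open Scope ring_scope.

(** * Finite-horizon Markov decision processes *)

Record mdp (R : realType) (S A : finType) := MDP {
  trans : S -> A -> S -> R;
  reward : S -> A -> R;
  horizon : nat;
  trans_ge0 : forall s a t, 0 <= trans s a t;
  trans_sum1 : forall s a, \sum_(t : S) trans s a t = 1;
  reward_ge0 : forall s a, 0 <= reward s a;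
  reward_le1 : forall s a, reward s a <= 1;
  horizon_gt0 : (0 < horizon)%N;
  states_gt0 : (0 < #|S|)%N;
  actions_gt0 : (0 < #|A|)%N
}.

Section Values.
Variables (R : realType) (S A : finType) (M : mdp R S A).

(* Stages are numbered from 0: [h : 'I_(horizon M)] is the stage usually called
   [h + 1], and index [horizon M] is the end of the process. *)
Definition policy := S * 'I_(horizon M) -> A.

Definition qvalue (v : S -> R) (s : S) (a : A) : R :=
  reward M s a + \sum_(t : S) trans M s a t * v t.

Definition policy_value (pi : policy) (h : nat) : S -> R :=
  foldr (fun (j : 'I_(horizon M)) v s => qvalue v s (pi (s, j)))
        (fun=> 0) (drop h (enum 'I_(horizon M))).

(* The default value 0 of the maximum is harmless: [A] is nonempty and all
   the values to which this is applied are nonnegative, see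
   [optimal_value_max]. *)
Definition optimal_backup (v : S -> R) (s : S) : R :=
  \big[Num.max/0]_(a : A) qvalue v s a.

Definition optimal_value (h : nat) : S -> R :=
  iter (horizon M - h) optimal_backup (fun=> 0).

Lemma policy_value_end (pi : policy) (s : S) :
  policy_value pi (horizon M) s = 0.
Proof. by rewrite /policy_value drop_oversize // size_enum_ord. Qed.

Lemma policy_value_step (pi : policy) (h : 'I_(horizon M)) (s : S) :
  policy_value pi h s =
  reward M s (pi (s, h))
  + \sum_(t : S) trans M s (pi (s, h)) t * policy_value pi h.+1 t.
Proof.
rewrite /policy_value (drop_nth h) ?size_enum_ord //=.
by rewrite nth_ord_enum.
Qed.

Lemma optimal_value_end (s : S) : optimal_value (horizon M) s = 0.
Proof. by rewrite /optimal_value subnn. Qed.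

Lemma optimal_value_ge0 (h : nat) (s : S) : 0 <= optimal_value h s.
Proof.
rewrite /optimal_value; case: (_ - _)%N => [|k] //=.
exact: bigmax_ge_id.
Qed.

Lemma optimal_value_max (h : 'I_(horizon M)) (s : S) :
  (forall a, reward M s a + \sum_(t : S) trans M s a t * optimal_value h.+1 t
             <= optimal_value h s)
  /\ (exists a, optimal_value h s =
        reward M s a + \sum_(t : S) trans M s a t * optimal_value h.+1 t).
Proof.
have -> : optimal_value h s = optimal_backup (optimal_value h.+1) s.
  by rewrite /optimal_value -(subnSK (ltn_ord h)).
split=> [a|]; first exact: (le_bigmax _ (qvalue (optimal_value h.+1) s)).
have /card_gt0P[a0 _] := actions_gt0 M.
exists [arg max_(a > a0) qvalue (optimal_value h.+1) s a]%O.
case: arg_maxP => // a _ maxa; apply/le_anti/andP; split.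
  apply/bigmax_leP; split=> [|b _]; last exact: maxa.
  rewrite addr_ge0 ?reward_ge0 // sumr_ge0 // => t _.
  by rewrite mulr_ge0 ?trans_ge0 ?optimal_value_ge0.
exact: (le_bigmax _ (qvalue (optimal_value h.+1) s)).
Qed.

End Values.

(** * A real RAM with a sampling oracle

  Algorithms are programs of a unit-cost real RAM.  The memory consists of
  arrays of natural numbers and arrays of real numbers, all of unbounded
  length and named by natural numbers.  Array names and integer constants are
  part of the program text, indices are computed at run time.  There is no
  conversion from reals to naturals. *)

Inductive nexp :=
  | NConst of nat
  | NCell of nat & nexp
  | NAdd of nexp & nexp
  | NSub of nexp & nexp
  | NMul of nexp & nexp.

Inductive rexp :=
  | RNat of nexp
  | RCell of nat & nexp
  | RAdd of rexp & rexp
  | RSub of rexp & rexp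
  | RMul of rexp & rexp
  | RDiv of rexp & rexp
  | RSqrt of rexp.

Inductive bexp :=
  | BNle of nexp & nexp
  | BRle of rexp & rexp
  | BNot of bexp.

(* [NSet x i e] and [RSet x i e] write the value of [e] to cell [i] of array
   [x]; [Sample x i s a] writes to cell [i] of natural-number array [x] the
   index of a state drawn by the oracle for the pair with indices [s], [a]. *)
Inductive instr :=
  | NSet of nat & nexp & nexp
  | RSet of nat & nexp & rexp
  | Sample of nat & nexp & nexp & nexp
  | If of bexp & seq instr & seq instr
  | While of bexp & seq instr.

Definition update (T : Type) (m : nat -> nat -> T) (x i : nat) (v : T) :
    nat -> nat -> T :=
  fun y j => if (y == x) && (j == i) then v else m y j.

Section Machine.
Variable R : realType.

(* [code] is what remains to be executed, [calls] counts the oracle calls made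
   so far and cannot be read by the program. *)
Record config := Config {
  code : seq instr;
  nmem : nat -> nat -> nat;
  rmem : nat -> nat -> R;
  calls : nat
}.

Fixpoint neval (c : config) (e : nexp) : nat :=
  match e with
  | NConst n => n
  | NCell x i => nmem c x (neval c i)
  | NAdd e1 e2 => neval c e1 + neval c e2
  | NSub e1 e2 => neval c e1 - neval c e2
  | NMul e1 e2 => neval c e1 * neval c e2
  end%N.

Fixpoint reval (c : config) (e : rexp) : R :=
  match e with
  | RNat n => (neval c n)%:R
  | RCell x i => rmem c x (neval c i)
  | RAdd e1 e2 => reval c e1 + reval c e2
  | RSub e1 e2 => reval c e1 - reval c e2
  | RMul e1 e2 => reval c e1 * reval c e2
  | RDiv e1 e2 => reval c e1 / reval c e2
  | RSqrt e1 => Num.sqrt (reval c e1)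
  end.

Fixpoint beval (c : config) (b : bexp) : bool :=
  match b with
  | BNle e1 e2 => (neval c e1 <= neval c e2)%N
  | BRle e1 e2 => reval c e1 <= reval c e2
  | BNot b1 => ~~ beval c b1
  end.

Variables S A : finType.

Inductive transition :=
  | Halted
  | Next of config
  | Draw of S & A & (S -> config).

(* One step executes one instruction or evaluates one test.  The expressions
   of a program have bounded size, so charging one unit for an instruction
   rather than one per operation changes the running time by a constant
   factor only.  States and actions are represented by their ranks in
   [enum S] and [enum A]; a machine that queries the oracle at an index out of
   range loops forever. *)
Definition step (c : config) : transition :=
  match code c with
  | [::] => Halted
  | NSet x i e :: k =>
      Next (Config k (update (nmem c) x (neval c i) (neval c e))
                   (rmem c) (calls c))
  | RSet x i e :: k =>
      Next (Config k (nmem c) (update (rmem c) x (neval c i) (reval c e))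
                   (calls c))
  | Sample x i s a :: k =>
      match insub (neval c s) : option 'I_#|S|,
            insub (neval c a) : option 'I_#|A| with
      | Some s', Some a' =>
          Draw (enum_val s') (enum_val a') (fun t =>
            Config k (update (nmem c) x (neval c i) (enum_rank t))
                   (rmem c) (calls c).+1)
      | _, _ => Next c
      end
  | If b k1 k2 :: k =>
      Next (Config ((if beval c b then k1 else k2) ++ k)
                   (nmem c) (rmem c) (calls c))
  | While b k1 :: k =>
      Next (Config (if beval c b then k1 ++ code c else k)
                   (nmem c) (rmem c) (calls c))
  end.

Variable M : mdp R S A.

(* Probability that the machine started in [c] halts within [n] steps, in a
   configuration satisfying [E].  Each oracle call draws a fresh state from
   [trans M s a], independently of the past. *)
Fixpoint halt_prob (E : config -> Prop) (n : nat) (c : config) : R :=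
  match step c, n with
  | Halted, _ => `[< E c >]%:R
  | _, 0%N => 0
  | Next c', n'.+1 => halt_prob E n' c'
  | Draw s a k, n'.+1 => \sum_(t : S) trans M s a t * halt_prob E n' (k t)
  end.

(* Input: |S|, |A|, H in natural-number array 0; eps, delta in real array 0;
   the reward matrix, row by row, in real array 1.  All other cells are 0. *)
Definition input_nmem : nat -> nat -> nat := fun x i =>
  if x == 0%N then nth 0%N [:: #|S|; #|A|; horizon M] i else 0%N.

Definition input_rmem (eps delta : R) : nat -> nat -> R := fun x i =>
  if x == 0%N then nth 0 [:: eps; delta] i
  else if x == 1%N then nth 0 [seq reward M s a | s <- enum S, a <- enum A] i
  else 0.

Definition start (prog : seq instr) (eps delta : R) : config :=
  Config prog input_nmem (input_rmem eps delta) 0.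

(* Output: the policy, stage by stage, in natural-number array 1. *)
Definition outputs (c : config) (pi : policy M) : Prop :=
  forall (s : S) (h : 'I_(horizon M)),
    nmem c 1 (h * #|S| + enum_rank s)%N = enum_rank (pi (s, h)).

End Machine.

(* Main.v *)
(** Variance-reduced value iteration.  Values [v0] with |v0 - v*| <= u are
  improved by a backward pass: P v0 is estimated from about H^3 / eps^2 samples
  per state-action pair, shared by all stages, and P (v - v0) from about
  H^2 / eps^2 fresh samples at every stage; v is the maximum of the estimated
  action values, and the policy is greedy.  Each pass halves u, so that
  log2 (H / eps) passes are enough.  As v0 is independent of the samples of its
  pass and v_{h+1} of those of stage h, a Bernstein bound applies in the linear
  form: the deviation is at most alpha Var(v*_{h+1}) + beta.  The function
  W_h = 2 H v*_h - v*_h^2 satisfies Var(v*_{h+1}) + P W_{h+1} <= W_h for every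
  action, so the errors accumulated along any trajectory are at most
  alpha H^2 + beta H, both for the values and for the greedy policy. *)

Require Import Defs.
From mathcomp Require Import all_boot all_order all_algebra.
From mathcomp Require Import sequences boolp reals exp.
From mathcomp Require Import ring lra zify.

Set Implicit Arguments.
Unset Strict Implicit.
Unset Printing Implicit Defensive.

Import Order.TTheory GRing.Theory Num.Theory.
Local Open Scope ring_scope.

(** * Optimal values and approximate backups *)

(** No probability space is built. A run is the recursion [halt_prob], and each guarantee is a lower
    bound on it, uniform in the continuation. Independence becomes a matter of timing: a function
    read off the memory before a sampling loop starts is constant during that loop, and the
    exponential moments form a nonnegative supermartingale along it. The union over stages and signs
    is taken inside this one supermartingale.

    The exponents of the Chernoff bounds are fixed in advance instead of being tuned to the
    variance. The resulting bound has no square root, the program need not estimate any variance,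
    and linearity in the variance is exactly what W_h can sum along a trajectory.

    Two kinds of statements concern the same runs: cost and a well-formed output with probability 1,
    accuracy only up to [delta]. The flag [good] lets one proof serve both.

    The machine has neither logarithms nor rounding, so the accuracy, the logarithmic factor and the
    number of passes come from doubling loops, as exponents of least sufficient powers of two. *)

Section Optimality.
Variables (R : realType) (S A : finType) (M : mdp R S A).
Implicit Types (f g v : S -> R) (s t : S) (a : A) (h : nat).

Let H : nat := horizon M.

Definition mean s a f : R := \sum_(t : S) trans M s a t * f t.

Definition variance s a f : R := mean s a (fun t => f t ^+ 2) - mean s a f ^+ 2.

Lemma eq_mean s a f g : f =1 g -> mean s a f = mean s a g.
Proof. by move=> fg; apply: eq_bigr => t _; rewrite fg. Qed.

Lemma mean_cst s a (x : R) : mean s a (fun=> x) = x.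
Proof. by rewrite /mean -mulr_suml trans_sum1 mul1r. Qed.

Lemma meanD s a f g : mean s a (fun t => f t + g t) = mean s a f + mean s a g.
Proof. by rewrite /mean -big_split; apply: eq_bigr => t _; rewrite mulrDr. Qed.

Lemma meanZ s a (x : R) f : mean s a (fun t => x * f t) = x * mean s a f.
Proof. by rewrite /mean mulr_sumr; apply: eq_bigr => t _; rewrite mulrCA. Qed.

Lemma meanB s a f g : mean s a (fun t => f t - g t) = mean s a f - mean s a g.
Proof.
rewrite -[- mean _ _ g]mulN1r -meanZ -meanD.
by apply: eq_mean => t; rewrite mulN1r.
Qed.

Lemma le_mean s a f g : (forall t, f t <= g t) -> mean s a f <= mean s a g.
Proof. by move=> fg; apply: ler_sum => t _; rewrite ler_wpM2l ?trans_ge0. Qed.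

Lemma mean_le s a f (x : R) : (forall t, f t <= x) -> mean s a f <= x.
Proof. by move=> fx; rewrite -[leRHS](mean_cst s a); apply: le_mean. Qed.

Lemma mean_ge s a f (x : R) : (forall t, x <= f t) -> x <= mean s a f.
Proof. by move=> fx; rewrite -[leLHS](mean_cst s a); apply: le_mean. Qed.

Lemma mean_abs_le s a f (x : R) :
  (forall t, `|f t| <= x) -> `|mean s a f| <= x.
Proof.
move=> fx; rewrite ler_norml mean_ge ?mean_le // => t.
- by have := fx t; rewrite ler_norml => /andP[].
- by have := fx t; rewrite ler_norml => /andP[].
Qed.

Lemma qvalueE v s a : qvalue M v s a = reward M s a + mean s a v.
Proof. by []. Qed.

Lemma mean_sqr_center s a f (x : R) :
  mean s a (fun t => (f t - x) ^+ 2)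
  = variance s a f + (mean s a f - x) ^+ 2.
Proof.
rewrite (@eq_mean s a _ (fun t => (f t ^+ 2 - (2 * x) * f t) + x ^+ 2)); last first.
  by move=> t; ring.
by rewrite meanD meanB meanZ mean_cst /variance; ring.
Qed.

Lemma variance_ge0 s a f : 0 <= variance s a f.
Proof.
have := mean_sqr_center s a f (mean s a f).
rewrite subrr expr0n addr0 => <-.
by apply: mean_ge => t; rewrite sqr_ge0.
Qed.

Lemma variance_le_sqr s a f (x : R) :
  (forall t, `|f t| <= x) -> variance s a f <= x ^+ 2.
Proof.
move=> fx; rewrite /variance.
have : mean s a (fun t => f t ^+ 2) <= x ^+ 2.
  apply: mean_le => t; have := fx t; rewrite ler_norml => /andP[]; nra.
have := sqr_ge0 (mean s a f); lra.
Qed.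

Lemma varianceD_le s a f g :
  variance s a (fun t => f t + g t) <= 2 * variance s a f + 2 * variance s a g.
Proof.
have E e : variance s a e = mean s a (fun t => (e t - mean s a e) ^+ 2).
  by rewrite mean_sqr_center subrr expr0n addr0.
rewrite !E -!meanZ -meanD; apply: le_mean => t; rewrite meanD.
have := sqr_ge0 ((f t - mean s a f) - (g t - mean s a g)); lra.
Qed.

Lemma optimal_value_ge_qvalue h s a : (h < H)%N ->
  qvalue M (optimal_value M h.+1) s a <= optimal_value M h s.
Proof. by move=> hH; have [+ _] := optimal_value_max (Ordinal hH) s; apply. Qed.

Lemma optimal_value_attained h s : (h < H)%N ->
  exists a, optimal_value M h s = qvalue M (optimal_value M h.+1) s a.
Proof. by move=> hH; have [_] := optimal_value_max (Ordinal hH) s. Qed.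

Lemma optimal_value_le h s : optimal_value M h s <= (H - h)%:R.
Proof.
rewrite /optimal_value -/H; elim: (H - h)%N s => [|k IH] s //=.
apply/bigmax_leP; split=> [|a _]; first by rewrite ler0n.
rewrite qvalueE -[k.+1]add1n natrD lerD ?reward_le1 //.
exact: mean_le.
Qed.

Lemma optimal_value_le_horizon h s : optimal_value M h s <= H%:R.
Proof. by rewrite (le_trans (optimal_value_le h s)) // ler_nat leq_subr. Qed.

Lemma policy_value_bounds (pi : policy M) h s : (h <= H)%N ->
  0 <= policy_value pi h s <= optimal_value M h s.
Proof.
move=> hH; have [k] := ubnP (H - h); elim: k h s hH => // k IH h s.
rewrite leq_eqVlt => /orP[/eqP -> _|hH Hk].
  by rewrite policy_value_end optimal_value_end lexx.
rewrite (policy_value_step pi (Ordinal hH)) /=.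
have Hk' : (H - h.+1 < k)%N by lia.
have ihs t := IH h.+1 t hH Hk'; apply/andP; split.
  rewrite addr_ge0 ?reward_ge0 //; apply: mean_ge => t.
  by have /andP[] := ihs t.
apply: le_trans (optimal_value_ge_qvalue s (pi (s, Ordinal hH)) hH).
rewrite qvalueE lerD2l; apply: le_mean => t.
by have /andP[] := ihs t.
Qed.

Definition variance_potential h s : R :=
  2 * H%:R * optimal_value M h s - optimal_value M h s ^+ 2.

(** The second moments cancel: with [m] the mean of the next optimal value, the left side is
    [2 * H * m - m ^+ 2]. Since [m <= v*_h <= H] and [2 * H * y - y ^+ 2] increases for [y <= H],
    the claim follows. *)
Lemma variance_potential_step h s a : (h < H)%N ->
  variance s a (optimal_value M h.+1) + mean s a (variance_potential h.+1)
  <= variance_potential h s.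
Proof.
move=> hH; rewrite /variance /variance_potential meanB meanZ.
have := optimal_value_ge_qvalue s a hH; rewrite qvalueE.
have := reward_ge0 M s a.
have := optimal_value_le_horizon h s.
have m0 : 0 <= mean s a (optimal_value M h.+1).
  by apply: mean_ge => t; exact: optimal_value_ge0.
move: m0; set m := mean _ _ (optimal_value _ _); set m2 := mean _ _ _.
set x := optimal_value M h s; set r := reward _ _ _ => m0 xH r0 rmx.
have : 0 <= (x - m) * (2 * H%:R - x - m) by apply: mulr_ge0; lra.
lra.
Qed.

Lemma variance_potential_ge0 h s : 0 <= variance_potential h s.
Proof.
have := optimal_value_le_horizon h s; have := optimal_value_ge0 M h s.
by rewrite /variance_potential; nra.
Qed.

Lemma variance_potential_le h s : variance_potential h s <= H%:R ^+ 2.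
Proof.
rewrite /variance_potential.
have := sqr_ge0 (H%:R - optimal_value M h s); lra.
Qed.

(** * Propagation of errors through approximate backups *)

Section ApproximateIteration.
Variables (alpha beta : R) (v : nat -> S -> R).
Hypotheses (alpha_ge0 : 0 <= alpha) (beta_ge0 : 0 <= beta).

Definition backup_error h s a : R :=
  alpha * variance s a (optimal_value M h.+1) + beta.

Definition value_error h s : R :=
  alpha * variance_potential h s + beta * (H - h)%:R.

(** [value_error] is a supersolution of the error recursion for every action at once. Errors can
    thus be propagated pointwise, a uniform bound being taken only afterwards. *)
Lemma value_error_step h s a : (h < H)%N ->
  backup_error h s a + mean s a (value_error h.+1) <= value_error h s.
Proof.
move=> hH; rewrite /backup_error /value_error meanD meanZ mean_cst.
have := ler_wpM2l alpha_ge0 (variance_potential_step s a hH).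
have -> : (H - h = (H - h.+1).+1)%N by rewrite subnSK.
by rewrite -natr1; lra.
Qed.

Lemma value_error_ge0 h s : 0 <= value_error h s.
Proof. by rewrite addr_ge0 ?mulr_ge0 ?variance_potential_ge0. Qed.

Lemma value_error_le h s :
  value_error h s <= alpha * H%:R ^+ 2 + beta * H%:R.
Proof.
rewrite lerD // ler_wpM2l ?variance_potential_le //.
by rewrite ler_nat leq_subr.
Qed.

(** One-sided for actions other than [a]: bounding [v] from above needs only the selected action,
    while from below [v] is compared with the optimal action, which the program does not know. *)
Definition approximate_backup h s a : Prop :=
  `|v h s - qvalue M (v h.+1) s a| <= backup_error h s a /\
  forall b, qvalue M (v h.+1) s b - backup_error h s b <= v h s.

Hypothesis v_end : forall s, v H s = 0.

(** The hypothesis concerns only stages from [h0] on, so that the lemma applies in the middle of a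
    backward pass, where closeness of the row just computed is needed for the concentration bound of
    the next stage. *)
Lemma approximate_iteration_value h0 :
  (forall h s, (h0 <= h < H)%N -> exists a, approximate_backup h s a) ->
  forall h s, (h0 <= h <= H)%N -> `|v h s - optimal_value M h s| <= value_error h s.
Proof.
move=> G h s /andP[h0h hH]; have [k] := ubnP (H - h).
elim: k h s h0h hH => // k IH h s h0h.
rewrite leq_eqVlt => /orP[/eqP -> _|hH Hk].
  by rewrite v_end optimal_value_end subrr normr0 value_error_ge0.
have Hk' : (H - h.+1 < k)%N by lia.
have {IH} ih t : `|v h.+1 t - optimal_value M h.+1 t| <= value_error h.+1 t.
  by apply: IH => //; lia.
have close a : mean s a (v h.+1) - mean s a (optimal_value M h.+1)
      <= mean s a (value_error h.+1) /\
    mean s a (optimal_value M h.+1) - mean s a (v h.+1)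
      <= mean s a (value_error h.+1).
  rewrite -!meanB; split; apply: le_mean => t;
    by have := ih t; rewrite ler_norml; lra.
have [|a []] := G h s; first by rewrite h0h.
have [b optb] := optimal_value_attained s hH.
rewrite !ler_norml !qvalueE => /andP[_ va] /(_ b); rewrite qvalueE => vb.
have := optimal_value_ge_qvalue s a hH.
move: optb; rewrite !qvalueE.
have := value_error_step s a hH; have := value_error_step s b hH.
have [? ?] := close a; have [? ?] := close b.
by lra.
Qed.

(** The computed [v] is the intermediate term: it lies at most one [value_error] below the optimal
    value, and the policy value lies at most one more below [v]. *)
Lemma approximate_iteration_policy (pi : policy M) :
  (forall s (h : 'I_H), approximate_backup h s (pi (s, h))) ->
  forall h s, (h <= H)%N ->
  optimal_value M h s - 2 * value_error h s <= policy_value pi h s.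
Proof.
move=> G.
suff low h s : (h <= H)%N -> v h s - value_error h s <= policy_value pi h s.
  move=> h s hH; have := low h s hH.
  have := @approximate_iteration_value 0 _ h s hH.
  rewrite ler_norml => /(_ _)/andP[]; last by lra.
  by move=> h' s' h'H; exists (pi (s', Ordinal h'H)); exact: G (Ordinal h'H).
move=> hH; have [k] := ubnP (H - h).
elim: k h s hH => // k IH h s.
rewrite leq_eqVlt => /orP[/eqP -> _|hH Hk].
  rewrite v_end policy_value_end.
  by have := value_error_ge0 H s; lra.
have Hk' : (H - h.+1 < k)%N by lia.
rewrite (policy_value_step pi (Ordinal hH)) /=; set a := pi _.
have ih : mean s a (v h.+1) - mean s a (value_error h.+1)
      <= mean s a (policy_value pi h.+1).
  by rewrite -meanB; apply: le_mean => t; apply: IH.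
have [] := G s (Ordinal hH); rewrite -/a /= ler_norml qvalueE => /andP[_] + _.
have := value_error_step s a hH; move: ih; rewrite /mean; lra.
Qed.

End ApproximateIteration.
End Optimality.

(** * Concentration *)

Section Concentration.
Variables (R : realType) (S A : finType) (M : mdp R S A) (s : S) (a : A).

(** Here [expR y <= (1 - y)^-1], and [(1 - y) * (1 + y + 2 * y ^+ 2) = 1 + y ^+ 2 * (1 - 2 * y)]. *)
Lemma expR_le_quadratic (y : R) : y <= 2^-1 -> expR y <= 1 + y + 2 * y ^+ 2.
Proof.
move=> y2; rewrite -[y in leLHS]opprK expRN.
have y1 : 1 - y <= expR (- y) by exact: expR_ge1Dx.
have y0 : 0 < 1 - y by lra.
rewrite (@le_trans _ _ (1 - y)^-1) ?lef_pV2 ?posrE ?expR_gt0 //.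
rewrite -[leLHS]mul1r ler_pdivrMr //.
have : 0 <= y ^+ 2 * (1 - 2 * y) by rewrite mulr_ge0 ?sqr_ge0 //; lra.
by lra.
Qed.

Lemma mean_expR_le (g : S -> R) (w : R) :
  mean M s a g = 0 -> (forall t, `|g t| <= 2^-1) ->
  mean M s a (fun t => g t ^+ 2) <= w ->
  mean M s a (fun t => expR (g t)) <= expR (2 * w).
Proof.
move=> g0 gle gw; apply: le_trans (expR_ge1Dx _).
rewrite (@le_trans _ _ (mean M s a (fun t => 1 + g t + 2 * g t ^+ 2))) //.
  apply: le_mean => t; apply: expR_le_quadratic.
  by have := gle t; rewrite ler_norml => /andP[].
by rewrite !meanD meanZ mean_cst g0; lra.
Qed.

Variables (J : finType) (f : J -> S -> R) (lambda sigma : J -> R) (ell : R).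
Hypothesis lambda_gt0 : forall j, 0 < lambda j.
Hypothesis f_bounded :
  forall j t, lambda j * `|f j t - mean M s a (f j)| <= 2^-1.
Hypothesis f_variance : forall j, variance M s a (f j) <= sigma j.

Definition deviation j (ts : seq S) : R :=
  \sum_(t <- ts) (f j t - mean M s a (f j)).

(** A potential for all functions [f j] and both signs together. The compensator
    [2 n lambda^2 sigma] pays for the exponential moments, and the shift by [ell] normalises the
    threshold of failure to 1. *)
Definition chernoff (ts : seq S) : R :=
  \sum_j \sum_(b : bool) expR ((-1) ^+ b * lambda j * deviation j ts
    - 2 * (size ts)%:R * (lambda j ^+ 2 * sigma j) - ell).

Lemma chernoff_ge0 ts : 0 <= chernoff ts.
Proof. by apply: sumr_ge0 => j _; apply: sumr_ge0 => b _; exact: expR_ge0. Qed.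

Lemma chernoff_nil : chernoff [::] = 2 * #|J|%:R * expR (- ell).
Proof.
rewrite /chernoff (eq_bigr (fun=> 2 * expR (- ell))) => [|j _].
  by rewrite sumr_const -mulr_natr; ring.
by rewrite big_bool /deviation big_nil /= !mulr0 mul0r subr0 add0r; ring.
Qed.

(** One more draw multiplies each summand by the exponential moment of a centred variable, which
    [mean_expR_le] bounds by the factor that the compensator removes. *)
Lemma chernoff_supermartingale ts :
  mean M s a (fun t => chernoff (rcons ts t)) <= chernoff ts.
Proof.
rewrite /mean /chernoff.
under eq_bigr do rewrite mulr_sumr.
rewrite exchange_big; apply: ler_sum => j _ /=.
under eq_bigr do rewrite mulr_sumr.
rewrite exchange_big; apply: ler_sum => b _ /=.
set c := expR _.
rewrite (eq_bigr (fun t => trans M s a t *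
  ((c * expR (- (2 * (lambda j ^+ 2 * sigma j)))) *
   expR ((-1) ^+ b * lambda j * (f j t - mean M s a (f j)))))); last first.
  move=> t _; congr (_ * _); rewrite /c -!expRD; congr expR.
  rewrite /deviation size_rcons -cats1 big_cat big_seq1 -natr1 /=; ring.
rewrite -[X in X <= _]/(mean M s a (fun t => _ * _)) meanZ.
rewrite -[leRHS]mulr1 -mulrA ler_wpM2l ?expR_ge0 //.
rewrite mulrC expRN ler_pdivrMr ?expR_gt0 // mul1r.
apply: mean_expR_le => [|t|].
- by rewrite meanZ meanB mean_cst subrr mulr0.
- by rewrite !normrM normrX normrN1 expr1n mul1r gtr0_norm.
rewrite (@eq_mean _ _ _ _ _ _ _ (fun t => lambda j ^+ 2 *
    (f j t - mean M s a (f j)) ^+ 2)); last first.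
  by move=> t; rewrite !exprMn sqrr_sign mul1r.
by rewrite meanZ mean_sqr_center subrr expr0n addr0 ler_wpM2l ?sqr_ge0.
Qed.

(** All summands are nonnegative, so each is below 1 and each exponent is negative; the two signs
    bound the absolute value. *)
Lemma chernoff_lt1 ts j : chernoff ts < 1 ->
  `|\sum_(t <- ts) f j t - (size ts)%:R * mean M s a (f j)| <=
    2 * (size ts)%:R * (lambda j * sigma j) + ell / lambda j.
Proof.
move=> ts1.
have -> : \sum_(t <- ts) f j t - (size ts)%:R * mean M s a (f j) =
    deviation j ts.
  by rewrite /deviation big_split /= big_const_seq count_predT iter_addr_0
             mulNrn mulr_natl.
have bnd (b : bool) : (-1) ^+ b * lambda j * deviation j ts <=
    2 * (size ts)%:R * (lambda j ^+ 2 * sigma j) + ell.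
  have : expR ((-1) ^+ b * lambda j * deviation j ts
    - 2 * (size ts)%:R * (lambda j ^+ 2 * sigma j) - ell) < 1.
    apply: le_lt_trans ts1.
    rewrite /chernoff (bigD1 j) //= (bigD1 b) //= -addrA lerDl addr_ge0 //.
      by apply: sumr_ge0 => ? _; exact: expR_ge0.
    by apply: sumr_ge0 => ? _; apply: sumr_ge0 => ? _; exact: expR_ge0.
  by rewrite expR_lt1; lra.
have l0 := lambda_gt0 j.
have -> : 2 * (size ts)%:R * (lambda j * sigma j) + ell / lambda j =
    (2 * (size ts)%:R * (lambda j ^+ 2 * sigma j) + ell) / lambda j.
  by field; rewrite gt_eqF.
rewrite ler_pdivlMr //.
have := bnd true; have := bnd false; rewrite expr0 expr1 => b0 b1.
by case: (ger0P (deviation j ts)) => _; lra.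
Qed.

End Concentration.

(** * A program logic for the sampling machine *)

(** A syntactic bound on the arrays that can change, so that the side conditions of framing are
    decided by computation. *)
Fixpoint nwrites (i : instr) : seq nat :=
  match i with
  | NSet x _ _ | Sample x _ _ _ => [:: x]
  | RSet _ _ _ => [::]
  | If _ k1 k2 => flatten (map nwrites k1) ++ flatten (map nwrites k2)
  | While _ k => flatten (map nwrites k)
  end.

Fixpoint rwrites (i : instr) : seq nat :=
  match i with
  | RSet x _ _ => [:: x]
  | NSet _ _ _ | Sample _ _ _ _ => [::]
  | If _ k1 k2 => flatten (map rwrites k1) ++ flatten (map rwrites k2)
  | While _ k => flatten (map rwrites k)
  end.

Definition nwritten (p : seq instr) := flatten (map nwrites p).
Definition rwritten (p : seq instr) := flatten (map rwrites p).

Lemma nwritten_cat p q : nwritten (p ++ q) = nwritten p ++ nwritten q.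
Proof. by rewrite /nwritten map_cat flatten_cat. Qed.

Lemma rwritten_cat p q : rwritten (p ++ q) = rwritten p ++ rwritten q.
Proof. by rewrite /rwritten map_cat flatten_cat. Qed.

Section Logic.
Variable R : realType.
Implicit Types (c : config R) (p : seq instr).

Definition load (k : seq instr) c := Config k (nmem c) (rmem c) (calls c).

Definition setn c x i v :=
  Config (code c) (update (nmem c) x i v) (rmem c) (calls c).

Definition setr c x i v :=
  Config (code c) (nmem c) (update (rmem c) x i v) (calls c).

Lemma neval_load k c e : neval (load k c) e = neval c e.
Proof. by elim: e => //= [x e ->|e -> e' ->|e -> e' ->|e -> e' ->]. Qed.

Lemma reval_load k c e : reval (load k c) e = reval c e.
Proof.
by elim: e => //= [n|x n|e -> e' ->|e -> e' ->|e -> e' ->|e -> e' ->|e ->] //;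
  rewrite neval_load.
Qed.

Lemma beval_load k c b : beval (load k c) b = beval c b.
Proof. by elim: b => //= [e e'|e e'|b -> //]; rewrite ?neval_load ?reval_load. Qed.

Definition unchanged (xs ys : seq nat) c c' :=
  (forall x i, x \notin xs -> nmem c' x i = nmem c x i) /\
  (forall y i, y \notin ys -> rmem c' y i = rmem c y i).

Definition frame p := unchanged (nwritten p) (rwritten p).

Lemma unchanged_trans xs ys c1 c2 c3 :
  unchanged xs ys c1 c2 -> unchanged xs ys c2 c3 -> unchanged xs ys c1 c3.
Proof.
move=> [n12 r12] [n23 r23].
by split=> x i xx; rewrite (n23, r23) ?(n12, r12).
Qed.

Lemma unchangedS xs ys xs' ys' c c' :
  {subset xs <= xs'} -> {subset ys <= ys'} ->
  unchanged xs ys c c' -> unchanged xs' ys' c c'.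
Proof.
move=> sx sy [n r]; split=> x i xx; first by rewrite n //; apply: contra (sx x) xx.
by rewrite r //; apply: contra (sy x) xx.
Qed.

Lemma unchanged_setn xs ys c x i v :
  x \in xs -> unchanged xs ys c (setn c x i v).
Proof.
move=> xin; split=> // y j; rewrite /= /update.
by case: eqP => [->|//]; rewrite xin.
Qed.

Lemma unchanged_setr xs ys c y i v :
  y \in ys -> unchanged xs ys c (setr c y i v).
Proof.
move=> xin; split=> // x j; rewrite /= /update.
by case: eqP => [->|//]; rewrite xin.
Qed.

Variables (S A : finType) (M : mdp R S A).

Lemma halt_prob_halted E n c :
  code c = [::] -> halt_prob M E n c = `[< E c >]%:R.
Proof. by case: c => k N r q /= ->; case: n. Qed.

Lemma halt_prob_next E n c c' :
  step S A c = Next S A c' -> halt_prob M E n.+1 c = halt_prob M E n c'.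
Proof. by move=> /= ->. Qed.

Lemma halt_prob_ge0 E n c : 0 <= halt_prob M E n c.
Proof.
elim: n c => [|n IH] c /=; case: (step S A c) => [|c'|s a k] //.
by apply: sumr_ge0 => t _; rewrite mulr_ge0 ?trans_ge0.
Qed.

Lemma halt_prob_le1 E n c : halt_prob M E n c <= 1.
Proof.
elim: n c => [|n IH] c /=; case: (step S A c) => [|c'|s a k] //;
  try by case: asboolP.
exact: mean_le.
Qed.

Lemma halt_probS E n c : halt_prob M E n.+1 c =
  match step S A c with
  | Halted => `[< E c >]%:R
  | Next c' => halt_prob M E n c'
  | Draw s a k => mean M s a (fun t => halt_prob M E n (k t))
  end.
Proof. by []. Qed.

Lemma halt_prob_leS E n c : halt_prob M E n c <= halt_prob M E n.+1 c.
Proof.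
elim: n c => [|n IH] c.
  rewrite halt_probS [leLHS]/=; case: (step S A c) => [|c'|s a k] //.
    exact: halt_prob_ge0.
  by apply: mean_ge => t; exact: halt_prob_ge0.
rewrite [leRHS]halt_probS halt_probS; case: (step S A c) => [|c'|s a k] //.
exact: le_mean.
Qed.

Lemma halt_prob_mono E m n c :
  (m <= n)%N -> halt_prob M E m c <= halt_prob M E n c.
Proof.
move=> /subnKC <-; elim: (n - m)%N => [|k IH]; first by rewrite addn0.
by rewrite addnS; apply: le_trans (halt_prob_leS _ _ _).
Qed.

(* [wp p c T D eta Q]: started in [c], [p] terminates within [T] steps and [D]
   oracle calls in a configuration satisfying [Q], except with probability at
   most [eta]; arrays not written to by [p] keep their contents.  Failure
   probabilities add up along a program, whence the quantification over the
   success probability [x] of the continuation. *)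
Definition wp p c (T D : nat) (eta : R) (Q : config R -> Prop) : Prop :=
  forall k E n x, x <= 1 ->
  (forall c', frame p c c' -> (calls c' <= calls c + D)%N -> Q c' ->
    x <= halt_prob M E n (load k c')) ->
  x - eta <= halt_prob M E (n + T) (load (p ++ k) c).

Lemma wp_weaken p c T D eta Q T' D' eta' (Q' : config R -> Prop) :
  wp p c T D eta Q ->
  (T <= T')%N -> (D <= D')%N -> eta <= eta' ->
  (forall c', frame p c c' -> Q c' -> Q' c') ->
  wp p c T' D' eta' Q'.
Proof.
move=> H TT DD ee QQ k E n x x1 Hx.
apply: le_trans (halt_prob_mono _ _ (_ : n + T <= n + T')%N); last by rewrite leq_add2l.
apply: le_trans (H k E n x x1 _); first by lra.
move=> c' fc Dc Qc; apply: Hx (QQ _ fc Qc) => //.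
by apply: leq_trans Dc _; rewrite leq_add2l.
Qed.

Lemma wp_nil c (Q : config R -> Prop) : Q c -> wp [::] c 0 0 0 Q.
Proof. by move=> Qc k E n x x1 Hx; rewrite subr0 addn0; apply: Hx; rewrite ?addn0. Qed.

Lemma wp_cat p1 p2 c T1 T2 D1 D2 eta1 eta2 Q1 Q :
  0 <= eta2 ->
  wp p1 c T1 D1 eta1 Q1 ->
  (forall c', frame p1 c c' -> Q1 c' -> wp p2 c' T2 D2 eta2 Q) ->
  wp (p1 ++ p2) c (T1 + T2) (D1 + D2) (eta1 + eta2) Q.
Proof.
move=> e0 H1 H2 k E n x x1 Hx.
rewrite [(T1 + T2)%N]addnC addnA -catA opprD addrA addrAC.
apply: H1 => [|c1 f1 l1 q1]; first by lra.
apply: (H2 c1 f1 q1) => // c2 f2 l2 q2; apply: Hx => //; last by lia.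
rewrite /frame nwritten_cat rwritten_cat.
apply: unchanged_trans (unchangedS _ _ f1) (unchangedS _ _ f2) => ? /=;
  by rewrite mem_cat => ->; rewrite ?orbT.
Qed.

Lemma wp_nset p c x i e T D eta Q :
  wp p (setn c x (neval c i) (neval c e)) T D eta Q ->
  wp (NSet x i e :: p) c T.+1 D eta Q.
Proof.
move=> H k E n y y1 Hy; rewrite addnS.
rewrite (@halt_prob_next _ _ _ (load (p ++ k) (setn c x (neval c i) (neval c e)))).
  apply: H => // c' f l q; apply: Hy => //.
  apply: (@unchanged_trans _ _ _ (setn c x (neval c i) (neval c e))).
    by apply: unchanged_setn; rewrite /= mem_head.
  by apply: unchangedS f => ? /=; rewrite // inE => ->; rewrite orbT.
by rewrite /step /= !neval_load.
Qed.

Lemma wp_rset p c x i e T D eta Q :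
  wp p (setr c x (neval c i) (reval c e)) T D eta Q ->
  wp (RSet x i e :: p) c T.+1 D eta Q.
Proof.
move=> H k E n y y1 Hy; rewrite addnS.
rewrite (@halt_prob_next _ _ _ (load (p ++ k) (setr c x (neval c i) (reval c e)))).
  apply: H => // c' f l q; apply: Hy => //.
  apply: (@unchanged_trans _ _ _ (setr c x (neval c i) (reval c e))).
    by apply: unchanged_setr; rewrite /= mem_head.
  by apply: unchangedS f => ? /=; rewrite // inE => ->; rewrite orbT.
by rewrite /step /= !neval_load reval_load.
Qed.

Lemma wp_if p c b k1 k2 T D eta Q :
  wp ((if beval c b then k1 else k2) ++ p) c T D eta Q ->
  wp (If b k1 k2 :: p) c T.+1 D eta Q.
Proof.
move=> H k E n y y1 Hy; rewrite addnS.
rewrite (@halt_prob_next _ _ _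
  (load (((if beval c b then k1 else k2) ++ p) ++ k) c)).
  apply: H => // c' f l q; apply: Hy => //.
  apply: unchangedS f => z; rewrite ?nwritten_cat ?rwritten_cat /nwritten
    /rwritten /= !mem_cat; case: ifP => _ /orP[->|->]; by rewrite ?orbT.
by rewrite /step /= beval_load catA.
Qed.

Lemma wp_while b body c n T D eta (I : nat -> config R -> Prop) :
  0 <= eta ->
  I 0%N c ->
  (forall i c', frame [:: While b body] c c' -> I i c' -> beval c' b ->
    (i < n)%N /\ wp body c' T D eta (I i.+1)) ->
  wp [:: While b body] c (n * T.+1).+1 (n * D) (n%:R * eta)
    (fun c' => (exists i, I i c') /\ ~~ beval c' b).
Proof.
move=> e0 I0 H k E m x x1 Hx.
suff G r i c' : (i + r = n)%N -> frame [:: While b body] c c' ->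
    (calls c' <= calls c + i * D)%N -> I i c' ->
    x - r%:R * eta <= halt_prob M E (m + (r * T.+1).+1) (load (While b body :: k) c').
  by apply: (G n 0%N) => //; rewrite addn0.
elim: r i c' => [|r IH] i c' ir fc lc Ic.
  rewrite mul0r subr0 mul0n addn1.
  rewrite (@halt_prob_next _ _ _ (load k c')).
    apply: Hx => //; first by move: ir; rewrite addn0 => <-.
    split; first by exists i.
    by apply/negP => /(H _ _ fc Ic)[]; lia.
  rewrite /step /= beval_load; case: ifP => //.
  by move=> /(H _ _ fc Ic)[]; lia.
have rE : (m + (r.+1 * T.+1).+1 = (m + (r * T.+1).+1 + T).+1)%N by lia.
have rS : r.+1%:R * eta = r%:R * eta + eta by rewrite -natr1; ring.
have [bc|bc] := boolP (beval c' b); last first.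
  apply: (@le_trans _ _ x); first by rewrite gerBl mulr_ge0.
  rewrite rE (@halt_prob_next _ _ _ (load k c')); last first.
    by rewrite /step /= beval_load (negbTE bc).
  apply: le_trans (halt_prob_mono _ _ (_ : m <= _)%N); last by lia.
  apply: Hx; [by []| |by split; [exists i|]].
  apply: leq_trans lc _; rewrite leq_add2l leq_mul2r; apply/orP; right; lia.
have [_ Hb] := H _ _ fc Ic bc.
rewrite rE (@halt_prob_next _ _ _ (load (body ++ While b body :: k) c')); last first.
  by rewrite /step /= beval_load bc.
rewrite rS opprD addrA.
have r0 : 0 <= r%:R * eta by rewrite mulr_ge0.
apply: Hb; first by lra.
move=> c2 f2 l2 I2; apply: (IH i.+1) => //; first by lia.
  apply: unchanged_trans fc _; apply: unchangedS f2 => z;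
    by rewrite /nwritten /rwritten /= cats0.
by rewrite mulSn; lia.
Qed.

Definition For x (e : nexp) body :=
  [:: NSet x (NConst 0) (NConst 0);
   While (BNot (BNle e (NCell x (NConst 0))))
     (body ++ [:: NSet x (NConst 0) (NAdd (NCell x (NConst 0)) (NConst 1))])].

(** Test and increment turn [T] into [T.+2]; the initial assignment and the last test give the
    remaining 2 steps. The bound [e] is reevaluated at every test and must therefore be stable. *)
Lemma wp_for x e body c n T D eta (I : nat -> config R -> Prop) :
  0 <= eta -> x \notin nwritten body ->
  (forall c', frame (For x e body) c c' -> neval c' e = n) ->
  I 0%N (setn c x 0 0) ->
  (forall i c', (i < n)%N -> frame (For x e body) c c' -> nmem c' x 0 = i ->
    I i c' -> wp body c' T D eta (fun c2 => I i.+1 (setn c2 x 0 i.+1))) ->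
  wp (For x e body) c (n * T.+2 + 2) (n * D) (n%:R * eta) (I n).
Proof.
move=> e0 xb en I0 H; rewrite addn2; apply: wp_nset => /=.
set c0 := setn _ _ _ _.
have f0 : frame (For x e body) c c0.
  by apply: unchanged_setn; rewrite /nwritten /= mem_head.
have fS c' : frame [:: While (BNot (BNle e (NCell x (NConst 0))))
     (body ++ [:: NSet x (NConst 0) (NAdd (NCell x (NConst 0)) (NConst 1))])]
     c0 c' -> frame (For x e body) c c'.
  move=> f; apply: unchanged_trans f0 (unchangedS _ _ f) => z //=.
  by rewrite /nwritten /= inE => ->; rewrite orbT.
pose J i c' := I i c' /\ nmem c' x 0 = i /\ (i <= n)%N.
apply: (@wp_weaken _ _ _ _ _ _ _ _ _ _ (@wp_while _ _ c0 n T.+1 D eta J e0 _ _)) => //.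
- by split=> //; split => //; rewrite /= /update !eqxx.
- move=> i c' /fS fc [Ii [xi il]] /=; rewrite (en _ fc) xi => nl.
  split; first by lia.
  rewrite -[T.+1]addn1 -[D]addn0 -[eta]addr0.
  apply: wp_cat (H i c' _ fc xi Ii) _ => //; first by lia.
  move=> c2 f2 I2; apply: wp_nset => /=; apply: wp_nil.
  rewrite f2.1 // xi addn1; split=> //=; split; last by lia.
  by rewrite /update !eqxx.
- move=> c' /fS fc [[i [Ii [xi il]]]] /=.
  by rewrite (en _ fc) xi negbK => nl; have -> : n = i by lia.
Qed.

Definition SampleFor x i m base s a :=
  For i m [:: Sample x (NAdd base (NCell i (NConst 0))) s a].

(* Markov's inequality at the end of the loop: [Phi ts < 1] fails with
   probability at most the mean of [Phi ts]. *)
Lemma wp_sample_for x i m base s a c n b (s0 : S) (a0 : A) (Phi : seq S -> R) :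
  x != i ->
  (forall ts, 0 <= Phi ts) ->
  (forall ts, mean M s0 a0 (fun t => Phi (rcons ts t)) <= Phi ts) ->
  (forall c', frame (SampleFor x i m base s a) c c' ->
    [/\ neval c' m = n, neval c' base = b,
        neval c' s = enum_rank s0 & neval c' a = enum_rank a0]) ->
  wp (SampleFor x i m base s a) c (n * 3 + 2) n (Phi [::]) (fun c' =>
    (forall j, (j < b)%N || (b + n <= j)%N -> nmem c' x j = nmem c x j) /\
    exists ts : seq S, [/\ size ts = n, Phi ts < 1 &
      forall j, (j < n)%N ->
        nmem c' x (b + j)%N = nth 0%N [seq (enum_rank t : nat) | t <- ts] j]).
Proof.
move=> xi Phi0 Phis ev k E l y y1 Hy.
rewrite addn2 addnS.
pose W := While (BNot (BNle m (NCell i (NConst 0))))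
  [:: Sample x (NAdd base (NCell i (NConst 0))) s a;
      NSet i (NConst 0) (NAdd (NCell i (NConst 0)) (NConst 1))].
rewrite (@halt_prob_next _ _ _ (load (W :: k) (setn c i 0 0))); last first.
  by rewrite /step /= /SampleFor /For.
have ix : (i == x) = false by rewrite eq_sym; apply: negbTE.
(* After drawing [ts] the guarantee left is [y - Phi ts]. Each draw preserves it in mean, and if the
   loop ends with [Phi ts] at least 1 it is nonpositive and claims nothing. *)
suff G r c' ts : (size ts + r = n)%N ->
    frame (SampleFor x i m base s a) c c' ->
    calls c' = (calls c + size ts)%N ->
    nmem c' i 0 = size ts ->
    (forall j, (j < b)%N || (b + n <= j)%N -> nmem c' x j = nmem c x j) ->
    (forall j, (j < size ts)%N ->
      nmem c' x (b + j)%N = nth 0%N [seq (enum_rank t : nat) | t <- ts] j) ->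
    y - Phi ts <= halt_prob M E (l + (r * 3).+1) (load (W :: k) c').
  apply: (G n _ [::]) => //=; first by apply: unchanged_setn;
    rewrite /nwritten /= !inE eqxx ?orbT.
  - by rewrite addn0.
  - by rewrite /update !eqxx.
  - by move=> j _; rewrite /update (negbTE xi).
elim: r c' ts => [|r IH] c' ts sz fc lc ic oc tc;
  have [en eb es ea] := ev _ fc.
  rewrite addn0 in sz; rewrite mul0n addn1.
  rewrite (@halt_prob_next _ _ _ (load k c')); last first.
    by rewrite /step /= neval_load en ic sz leqnn.
  have [P1|P1] := ltP (Phi ts) 1; last first.
    by apply: le_trans (halt_prob_ge0 _ _ _); lra.
  apply: (@le_trans _ _ y); first by rewrite gerBl.
  apply: Hy => //; first by rewrite lc sz.
  by split=> //; exists ts; split; rewrite -?sz.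
have -> : (l + (r.+1 * 3).+1 = (l + (r * 3).+1).+3)%N by lia.
rewrite (@halt_prob_next _ _ _ (load
   [:: Sample x (NAdd base (NCell i (NConst 0))) s a,
      NSet i (NConst 0) (NAdd (NCell i (NConst 0)) (NConst 1)), W & k] c'));
  last first.
  rewrite /step /= neval_load en ic.
  by case: leqP => //; lia.
rewrite halt_probS /step /= !neval_load es ea.
rewrite (valK (enum_rank s0)) (valK (enum_rank a0)) !enum_rankK /= ic eb.
rewrite (@le_trans _ _ (mean M s0 a0 (fun t => y - Phi (rcons ts t)))) //.
  by rewrite meanB mean_cst lerB.
apply: le_mean => t.
pose c2 := setn (setn c' x (b + size ts)%N (enum_rank t)) i 0 (size ts).+1.
pose c3 := Config (code c2) (nmem c2) (rmem c2) (calls c').+1.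
rewrite (_ : halt_prob _ _ _ _ = halt_prob M E (l + (r * 3).+1) (load (W :: k) c3));
  last first.
  rewrite /c3 /c2 /load /=; congr (halt_prob _ _ _ (Config _ _ _ _)).
  by rewrite [update _ _ _ _ i 0%N]/update ix /= ic addn1.
apply: IH; rewrite ?size_rcons /=.
- by lia.
- apply: unchanged_trans fc _; rewrite /c3.
  have f2 : frame (SampleFor x i m base s a) c' c2.
    by apply: (@unchanged_trans _ _ _ (setn c' x (b + size ts)%N (enum_rank t)));
      apply: unchanged_setn; rewrite /nwritten /= !inE eqxx ?orbT.
  by case: f2.
- by rewrite lc addnS.
- by rewrite /update !eqxx.
- move=> j jb; rewrite /update (negbTE xi) /= eqxx /=.
  by case: eqP => [jE|_]; [lia|exact: oc].
- move=> j; rewrite ltnS leq_eqVlt /update (negbTE xi) /= eqxx /= eqn_add2l.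
  rewrite map_rcons nth_rcons size_map => /orP[/eqP->|jl].
    by rewrite eqxx ltnn.
  by rewrite jl (ltn_eqF jl) tc.
Qed.

End Logic.

(** * Derived loops: sums over memory and search for a power of two *)

Definition var x := NCell x (NConst 0).

Definition SumFor r i m e :=
  RSet r (NConst 0) (RNat (NConst 0)) ::
  For i m [:: RSet r (NConst 0) (RAdd (RCell r (NConst 0)) e)].

Definition Doubling y n e1 e2 :=
  [:: NSet y (NConst 0) (NConst 1); NSet n (NConst 0) (NConst 0);
      While (BNot (BRle e1 (RMul e2 (RNat (var y)))))
        [:: NSet y (NConst 0) (NAdd (var y) (var y));
            NSet n (NConst 0) (NAdd (var n) (NConst 1))]].

Section Macros.
Variables (R : realType) (S A : finType) (M : mdp R S A).

Lemma wp_sum_for r i m e (c : config R) n (g : nat -> R) :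
  (forall c', frame (SumFor r i m e) c c' -> neval c' m = n) ->
  (forall j c', (j < n)%N -> frame (SumFor r i m e) c c' -> nmem c' i 0 = j ->
    reval c' e = g j) ->
  wp M (SumFor r i m e) c (n * 3 + 3) 0 0
    (fun c' => rmem c' r 0 = \sum_(j < n) g j).
Proof.
move=> mn eg; rewrite addnS; apply: wp_rset; rewrite /= mulr0n.
set c0 := setr _ _ _ _.
have fS c' : frame (For i m [:: RSet r (NConst 0) (RAdd (RCell r (NConst 0)) e)])
    c0 c' -> frame (SumFor r i m e) c c'.
  move=> f; apply: (@unchanged_trans _ _ _ _ c0).
    by apply: unchanged_setr; rewrite /rwritten /= mem_head.
  by apply: unchangedS f => z //=; rewrite /rwritten /= !inE => ->.
have en c' : frame (For i m [:: RSet r (NConst 0) (RAdd (RCell r (NConst 0)) e)])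
    c0 c' -> neval c' m = n by move=> /fS; exact: mn.
pose I j (c' : config R) := rmem c' r 0 = \sum_(k < j) g k.
have I0 : I 0%N (setn c0 i 0 0) by rewrite /I /= /update !eqxx big_ord0.
have hbody j c' : (j < n)%N ->
    frame (For i m [:: RSet r (NConst 0) (RAdd (RCell r (NConst 0)) e)]) c0 c' ->
    nmem c' i 0 = j -> I j c' ->
    wp M [:: RSet r (NConst 0) (RAdd (RCell r (NConst 0)) e)] c' 1 0 0
      (fun c2 => I j.+1 (setn c2 i 0 j.+1)).
  move=> jn /fS fc ij Ij; apply: wp_rset; apply: wp_nil.
  by rewrite /I /= /update !eqxx Ij big_ord_recr /= (eg j).
have xb : i \notin nwritten [:: RSet r (NConst 0) (RAdd (RCell r (NConst 0)) e)].
  by [].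
by have := wp_for (lexx (0 : R)) xb en I0 hbody; rewrite muln0 mulr0.
Qed.

Lemma wp_doubling y n e1 e2 (c : config R) (v1 v2 : R) k :
  y != n ->
  (forall c', frame (Doubling y n e1 e2) c c' ->
    reval c' e1 = v1 /\ reval c' e2 = v2) ->
  v1 <= v2 * (2 ^ k)%:R -> (forall j, (j < k)%N -> v2 * (2 ^ j)%:R < v1) ->
  wp M (Doubling y n e1 e2) c (k * 3 + 3) 0 0
    (fun c' => nmem c' y 0 = (2 ^ k)%N /\ nmem c' n 0 = k).
Proof.
move=> yn ev vk vj; have ny : (n == y) = false by rewrite eq_sym; apply: negbTE.
rewrite !addnS addn0; apply: wp_nset; apply: wp_nset => /=.
set c0 := setn _ n _ _; set W := While _ _.
have fS c' : frame [:: W] c0 c' -> frame (Doubling y n e1 e2) c c'.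
  move=> f; apply: (@unchanged_trans _ _ _ _ (setn c y 0 1)).
    by apply: unchanged_setn; rewrite /nwritten /= mem_head.
  apply: (@unchanged_trans _ _ _ _ c0).
    by apply: unchanged_setn; rewrite /nwritten /= !inE eqxx orbT.
  by apply: unchangedS f => z //=; rewrite /nwritten /= !inE orbA => ->; rewrite !orbT.
pose I j (c' : config R) :=
  [/\ nmem c' y 0 = (2 ^ j)%N, nmem c' n 0 = j & (j <= k)%N].
have I0 : I 0%N c0 by split; rewrite //= /update !eqxx // eq_sym ny.
have hbody j c' : frame [:: W] c0 c' -> I j c' ->
    beval c' (BNot (BRle e1 (RMul e2 (RNat (var y))))) ->
    (j < k)%N /\ wp M [:: NSet y (NConst 0) (NAdd (var y) (var y));
       NSet n (NConst 0) (NAdd (var n) (NConst 1))] c' 2 0 0 (I j.+1).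
  move=> /fS fc [cy cn jk] /=; have [-> ->] := ev _ fc.
  rewrite cy -ltNge => lt1.
  have {}jk : (j < k)%N.
    rewrite ltn_neqAle jk andbT; apply: contraTneq lt1 => ->.
    by rewrite -leNgt.
  split=> //; apply: wp_nset; apply: wp_nset; apply: wp_nil.
  split=> //=; rewrite /update !eqxx ?ny /= ?(eq_sym y) ?ny ?cy ?cn ?addn1 //.
  by rewrite addnn expnS mul2n.
have := wp_while (lexx (0 : R)) I0 hbody; rewrite muln0 mulr0 => w.
apply: wp_weaken w _ _ _ _ => // c' /fS fc [[j [cy cn jk]] /=].
have [-> ->] := ev _ fc; rewrite cy negbK => le1.
suff <- : j = k by [].
apply/eqP; rewrite eqn_leq jk leqNgt; apply/negP => /vj.
by rewrite ltNge le1.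
Qed.

End Macros.

Lemma doubling_count (R : realType) (v1 v2 : R) : 0 < v2 ->
  exists k, v1 <= v2 * (2 ^ k)%:R /\ forall j, (j < k)%N -> v2 * (2 ^ j)%:R < v1.
Proof.
move=> v20.
have ex : exists k, v1 <= v2 * (2 ^ k)%:R.
  exists (Num.bound (v1 / v2)).
  by rewrite mulrC -ler_pdivrMr // natrX ltW // upper_nthrootP.
exists (ex_minn ex); case: ex_minnP => k vk kmin; split=> // j jk.
by rewrite ltNge; apply: contraL jk => /kmin; rewrite -leqNgt.
Qed.

(** * The algorithm *)

(* The program knows [e >= 1 / eps] and [l], an upper bound up to constants
   for the logarithm of [H |S| |A| / (delta eps)].  The factor [H - 1] makes
   the numbers of samples vanish when [H = 1]. *)
Definition stage_samples (H l e : nat) : nat :=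
  (128 * 128 * (H - 1) * H * l * e * e)%N.

(** For [H >= 2] the factor [H - 1] is at least [H / 2]. *)
Lemma stage_samples_ge (R : realFieldType) (H l e : nat) : (1 < H)%N ->
  128 * 128 * (H%:R / 2) * H%:R * l%:R * e%:R ^+ 2
  <= (stage_samples H l e)%:R :> R.
Proof.
move=> H1; rewrite /stage_samples -!mulnA !natrM natrB; last by lia.
have -> : 128 * (128 * ((H%:R - 1%:R) * (H%:R * (l%:R * (e%:R * e%:R))))) =
  128 * 128 * (H%:R - 1%:R) * H%:R * l%:R * e%:R ^+ 2 :> R by ring.
rewrite !ler_wpM2r ?sqr_ge0 ?ler0n //.
have : 2 <= H%:R :> R by rewrite ler_nat.
by lra.
Qed.

(** * Error of a single estimated action value *)

Section Estimate.
Variables (R : realType) (S A : finType) (M : mdp R S A).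
Let H : nat := horizon M.

Lemma horizonR_gt0 : 0 < H%:R :> R.
Proof. by rewrite ltr0n horizon_gt0. Qed.

(** Applied with [g] the optimal value, this trades the variance of the current values for that of
    the optimal ones, to which the variance potential applies. *)
Lemma le_variance_sum s a (f g : S -> R) (x : R) :
  (forall t, `|f t - g t| <= x) ->
  variance M s a f <= 2 * variance M s a g + 2 * x ^+ 2.
Proof.
move=> fg.
have -> : variance M s a f = variance M s a (fun t => g t + (f t - g t)).
  by rewrite /variance; congr (_ - _ ^+ 2); apply: eq_mean => t; rewrite subrKC.
apply: le_trans (varianceD_le _ _ _ _ _) _.
by rewrite lerD2l ler_wpM2l // variance_le_sqr.
Qed.

Variables (e l : nat) (u : R).
Hypotheses (e_gt1 : (1 < e)%N) (l_gt0 : (0 < l)%N).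
Hypotheses (u_ge : e%:R^-1 <= u) (u_le : u <= H%:R).

Variable m2 : nat.
Hypothesis m2_ge : (1 < H)%N ->
  128 * 128 * (H%:R / 2) * H%:R * l%:R * e%:R ^+ 2 <= m2%:R :> R.

Definition ell : R := 5 * l%:R.
(* The exponents of the two Chernoff bounds; the constants are chosen so that
   the exponential moments are controlled and the errors of a backward pass sum
   up to at most [u / 4]. *)
Definition lambda1 : R := (64 * H%:R ^+ 2 * e%:R)^-1.
Definition lambda2 : R := (128 * u * H%:R)^-1.
Definition alpha : R := 4 * lambda1.
Definition beta : R := (2 * u + e%:R^-1) / (16 * H%:R).

Let H0 := horizonR_gt0.

Let eR_ge2 : 2 <= e%:R :> R. Proof. by rewrite ler_nat. Qed.
Let e0 : 0 < e%:R :> R. Proof. by rewrite ltr0n ltnW. Qed.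
Let lR_ge1 : 1 <= l%:R :> R. Proof. by rewrite ler1n. Qed.

Lemma scale_gt0 : 0 < u.
Proof. by apply: lt_le_trans u_ge; rewrite invr_gt0. Qed.
Let u0 := scale_gt0.

Lemma lambda1_gt0 : 0 < lambda1.
Proof. by rewrite invr_gt0 !mulr_gt0 ?exprn_gt0. Qed.

Lemma lambda2_gt0 : 0 < lambda2.
Proof. by rewrite invr_gt0 !mulr_gt0. Qed.

Lemma alpha_ge0 : 0 <= alpha.
Proof. by rewrite mulr_ge0 // ltW ?lambda1_gt0. Qed.

Lemma beta_ge0 : 0 <= beta.
Proof.
have ei : 0 < e%:R^-1 :> R by rewrite invr_gt0.
by rewrite divr_ge0 //; have := H0; have := u0; lra.
Qed.

Lemma total_error_le : alpha * H%:R ^+ 2 + beta * H%:R <= u / 4.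
Proof.
have -> : alpha * H%:R ^+ 2 + beta * H%:R = (u + e%:R^-1) / 8.
  rewrite /alpha /beta /lambda1; field.
  by rewrite !gt_eqF //.
by move: u_ge; lra.
Qed.

Variables (V0 : nat -> S -> R).
Hypothesis V0_close :
  forall h t, (h <= H)%N -> `|V0 h t - optimal_value M h t| <= u.

(** All stages reuse the samples of the phase, so the union over the stages is part of the
    potential. *)
Definition chernoff1 s a : seq S -> R :=
  chernoff M s a (fun j : 'I_H => V0 j.+1) (fun=> lambda1)
    (fun j => 2 * variance M s a (optimal_value M j.+1) + 2 * u ^+ 2) ell.

Definition chernoff2 s a (V1 V2 : S -> R) : seq S -> R :=
  chernoff M s a (fun (j : 'I_1) t => V1 t - V2 t) (fun=> lambda2)
    (fun=> 4 * u ^+ 2) ell.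

Lemma chernoff1_bounded s a (j : 'I_H) t :
  lambda1 * `|V0 j.+1 t - mean M s a (V0 j.+1)| <= 2^-1.
Proof.
have V0b t' : `|V0 j.+1 t'| <= 2 * H%:R.
  have := V0_close t' (ltn_ord j); have := optimal_value_ge0 M j.+1 t'.
  have := optimal_value_le_horizon M j.+1 t'.
  by rewrite -/H !ler_norml; move: u_le; lra.
have : `|V0 j.+1 t - mean M s a (V0 j.+1)| <= 4 * H%:R.
  have := V0b t; have := mean_abs_le M s a V0b; rewrite !ler_norml; lra.
have Hge1 : 1 <= H%:R :> R by rewrite ler1n horizon_gt0.
move=> d; rewrite /lambda1 mulrC ler_pdivrMr ?mulr_gt0 ?exprn_gt0 //.
have e2 := eR_ge2.
have H2 : H%:R <= H%:R ^+ 2 :> R by rewrite expr2 ler_peMl.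
have := ler_wpM2l (sqr_ge0 (H%:R : R)) e2; lra.
Qed.

Lemma chernoff1_variance s a (j : 'I_H) :
  variance M s a (V0 j.+1)
  <= 2 * variance M s a (optimal_value M j.+1) + 2 * u ^+ 2.
Proof. by apply: le_variance_sum => t; apply: V0_close. Qed.

Section Difference.
Variables (s : S) (a : A) (V1 V2 : S -> R).
Hypothesis V12 : forall t, `|V1 t - V2 t| <= 2 * u.

Lemma chernoff2_bounded (j : 'I_1) t :
  lambda2 * `|V1 t - V2 t - mean M s a (fun t => V1 t - V2 t)| <= 2^-1.
Proof.
have : `|V1 t - V2 t - mean M s a (fun t => V1 t - V2 t)| <= 4 * u.
  have := V12 t; have := mean_abs_le M s a V12; rewrite !ler_norml; lra.
have Hge1 : 1 <= H%:R :> R by rewrite ler1n horizon_gt0.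
move=> d; rewrite /lambda2 mulrC ler_pdivrMr ?mulr_gt0 //.
have : u <= u * H%:R by rewrite ler_peMr // ltW.
by move: d; have := u0; lra.
Qed.

Lemma chernoff2_variance (j : 'I_1) :
  variance M s a (fun t => V1 t - V2 t) <= 4 * u ^+ 2.
Proof. by have := variance_le_sqr M s a V12; rewrite exprMn; lra. Qed.

End Difference.

Lemma estimate_error V1 h s a ts1 ts2 : (h < H)%N ->
  (forall t, `|V1 t - optimal_value M h.+1 t| <= u) ->
  (h.+1 = H -> forall t, V0 h.+1 t = 0 /\ V1 t = 0) ->
  size ts1 = (H * m2)%N -> size ts2 = m2 ->
  chernoff1 s a ts1 < 1 -> chernoff2 s a V1 (V0 h.+1) ts2 < 1 ->
  `|reward M s a + (\sum_(t <- ts1) V0 h.+1 t) / (H * m2)%:R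
    + (\sum_(t <- ts2) (V1 t - V0 h.+1 t)) / m2%:R - qvalue M V1 s a|
  <= backup_error M alpha beta h s a.
Proof.
move=> hH V1c Vend sz1 sz2 C1 C2.
have alpha0 := alpha_ge0; have beta0 := beta_ge0.
have vb : 0 <= backup_error M alpha beta h s a.
  by rewrite addr_ge0 // mulr_ge0 ?variance_ge0.
rewrite qvalueE.
have V12 t : `|V1 t - V0 h.+1 t| <= 2 * u.
  have := V1c t; have := V0_close t hH; rewrite !ler_norml; lra.
(* For [H = 1], [m2_ge] gives nothing and [m2] may be 0. But [h.+1] is then the terminal stage, both
   sums vanish whatever the denominators, and the estimate is exact. *)
have [H1|H1] := leqP H 1.
  have hE : h.+1 = H by apply/eqP; rewrite eqn_leq hH (leq_trans H1).
  rewrite big1 => [|t _]; last by have [] := Vend hE t.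
  rewrite big1 => [|t _]; last by have [-> ->] := Vend hE t; rewrite subrr.
  rewrite (_ : mean M s a V1 = 0) ?mul0r ?addr0 ?subrr ?normr0 //.
  rewrite -(mean_cst M s a (0 : R)); apply: eq_mean => t.
  by have [] := Vend hE t.
have m2ge := m2_ge H1.
have H2 : 2 <= H%:R :> R by rewrite ler_nat.
have e2 := eR_ge2; have l1 := lR_ge1.
have l0 : 0 < l%:R :> R by lra.
have m20 : 0 < m2%:R :> R.
  by apply: lt_le_trans m2ge; rewrite !mulr_gt0 ?exprn_gt0 //; lra.
have m1E : (H * m2)%:R = H%:R * m2%:R :> R by rewrite natrM.
have m10 : 0 < (H * m2)%:R :> R by rewrite natrM mulr_gt0.
have := chernoff_lt1 (fun=> lambda1_gt0) (Ordinal hH) C1.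
have := chernoff_lt1 (fun=> lambda2_gt0) (ord0 : 'I_1) C2.
rewrite /= sz1 sz2 -/H meanB.
set X1 := \sum_(t <- ts1) _; set X2 := \sum_(t <- ts2) _.
set y1 := mean _ _ _ V1; set y0 := mean _ _ _ (V0 _).
set var := variance _ _ _ _ => D2 D1.
have {}D1 : `|X1 / (H * m2)%:R - y0| <=
    2 * (lambda1 * (2 * var + 2 * u ^+ 2)) + ell / lambda1 / (H * m2)%:R.
  have -> : X1 / (H * m2)%:R - y0 = (X1 - (H * m2)%:R * y0) / (H * m2)%:R.
    by rewrite mulrBl mulrAC divff ?mul1r // gt_eqF.
  rewrite normrM [`|_^-1|]gtr0_norm ?invr_gt0 // ler_pdivrMr // mulrDl.
  rewrite mulfVK ?gt_eqF //.
  by move: D1; lra.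
have {}D2 : `|X2 / m2%:R - (y1 - y0)| <=
    2 * (lambda2 * (4 * u ^+ 2)) + ell / lambda2 / m2%:R.
  have -> : X2 / m2%:R - (y1 - y0) = (X2 - m2%:R * (y1 - y0)) / m2%:R.
    by field; rewrite gt_eqF.
  rewrite normrM [`|_^-1|]gtr0_norm ?invr_gt0 // ler_pdivrMr // mulrDl.
  rewrite mulfVK ?gt_eqF //.
  by move: D2; lra.
have -> : reward M s a + X1 / (H * m2)%:R + X2 / m2%:R - (reward M s a + y1) =
  (X1 / (H * m2)%:R - y0) + (X2 / m2%:R - (y1 - y0)) by ring.
apply: le_trans (ler_normD _ _) _.
have B1 : ell / lambda1 / (H * m2)%:R <= (16 * H%:R * e%:R)^-1.
  rewrite ler_pdivrMr // ler_pdivlMl ?mulr_gt0 // /ell /lambda1 invrK m1E.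
  apply: (@le_trans _ _ (H%:R * (128 * 128 * (H%:R / 2) * H%:R * l%:R * e%:R ^+ 2))).
    rewrite -subr_ge0.
    have -> : H%:R * (128 * 128 * (H%:R / 2) * H%:R * l%:R * e%:R ^+ 2) -
      16 * H%:R * e%:R * (5 * l%:R * (64 * H%:R ^+ 2 * e%:R)) =
      3072 * (H%:R ^+ 3 * l%:R * e%:R ^+ 2) :> R by field.
    by rewrite !mulr_ge0 ?exprn_ge0 ?ler0n.
  by rewrite ler_wpM2l.
have B2 : ell / lambda2 / m2%:R <= u / (32 * H%:R).
  rewrite ler_pdivrMr // [leRHS]mulrAC ler_pdivlMr ?mulr_gt0 // /ell /lambda2 invrK.
  apply: (@le_trans _ _ (u * (128 * 128 * (H%:R / 2) * H%:R * l%:R * e%:R ^+ 2))).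
    rewrite -subr_ge0.
    have -> : u * (128 * 128 * (H%:R / 2) * H%:R * l%:R * e%:R ^+ 2) -
      5 * l%:R * (128 * u * H%:R) * (32 * H%:R) =
      20 * 1024 * (2 / 5 * e%:R ^+ 2 - 1) * (u * H%:R ^+ 2 * l%:R) :> R by field.
    apply: mulr_ge0; last by rewrite !mulr_ge0 ?exprn_ge0 ?ltW.
    rewrite mulr_ge0 ?mulr_ge0 //.
    have : 4 <= e%:R ^+ 2 :> R.
      by rewrite expr2; have := ler_wpM2l (ltW e0) e2; lra.
    lra.
  by rewrite ler_wpM2l // ltW.
have B3 : 4 * (lambda1 * u ^+ 2) <= u / (32 * H%:R).
  rewrite /lambda1 mulrCA mulrC ler_pdivrMr ?mulr_gt0 ?exprn_gt0 //.
  rewrite [leRHS]mulrAC ler_pdivlMr ?mulr_gt0 // -subr_ge0.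
  have -> : u * (64 * H%:R ^+ 2 * e%:R) - 4 * u ^+ 2 * (32 * H%:R) =
    64 * u * H%:R * (H%:R * e%:R - 2 * u) by ring.
  apply: mulr_ge0; first by rewrite !mulr_ge0 ?ltW.
  rewrite subr_ge0; have := ler_wpM2l (ltW H0) e2; move: u_le; lra.
have B4 : 2 * (lambda2 * (4 * u ^+ 2)) = u / (16 * H%:R).
  by rewrite /lambda2; field; rewrite !gt_eqF.
(* [beta] collects [B3], the excess variance of [V0] over the optimal values; [B2] and [B4], the two
   terms for the difference; and [B1], the [ell] term of the shared samples. The remaining variance
   term has coefficient [4 * lambda1 = alpha]. *)
have B5 : beta = u / (32 * H%:R) + u / (32 * H%:R) + u / (16 * H%:R)
    + (16 * H%:R * e%:R)^-1.
  by rewrite /beta; field; rewrite !gt_eqF.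
rewrite /backup_error -/var B5 /alpha; move: D1 D2; lra.
Qed.

End Estimate.

Definition nS := NCell 0 (NConst 0).
Definition nA := NCell 0 (NConst 1).
Definition nH := NCell 0 (NConst 2).

(* Natural-number arrays: 2, 4, 6 hold the powers of two of the doubling loops
   with exponents in 7, 3, 5; 8 and 9 hold the numbers of samples per
   state-action pair for a phase and for a stage; 10 to 14 are the counters
   for phase, state, action, stage (backward) and sample; 15 and 16 store the
   samples of the phase and of the stage.  Real arrays: 2 and 3 hold the
   current values and those of the previous phase, 4 and 5 the two sums, 6 the
   estimated action value. *)
Definition pair_index := NAdd (NMul (var 11) nA) (var 12).
Definition block := NMul pair_index (var 8).
(** When counter 13 holds [i], the stage being treated is [H - i - 1]; row [H - i] is therefore the
    next stage, and [state_cell] lies in the row before it. *)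
Definition next_value x t := RCell x (NAdd (NMul (NSub nH (var 13)) nS) t).
Definition state_cell :=
  NAdd (NMul (NSub nH (NAdd (var 13) (NConst 1))) nS) (var 11).

Definition copy_values :=
  For 14 (NMul (NAdd nH (NConst 1)) nS) [:: RSet 3 (var 14) (RCell 2 (var 14))].

Definition phase_sampling :=
  For 11 nS (For 12 nA (SampleFor 15 14 (var 8) block (var 11) (var 12))).

Definition action_estimate :=
  SampleFor 16 14 (var 9) (NConst 0) (var 11) (var 12) ++
  SumFor 4 14 (var 8) (next_value 3 (NCell 15 (NAdd block (var 14)))) ++
  SumFor 5 14 (var 9) (RSub (next_value 2 (NCell 16 (var 14)))
                            (next_value 3 (NCell 16 (var 14)))).

(* The test is [a = 0 \/ v <= q], written as [a * (v - q) <= 0]. *)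
Definition action_update :=
  [:: RSet 6 (NConst 0) (RAdd (RAdd (RCell 1 pair_index)
        (RDiv (RCell 4 (NConst 0)) (RNat (var 8))))
        (RDiv (RCell 5 (NConst 0)) (RNat (var 9))));
      If (BRle (RMul (RNat (var 12)) (RSub (RCell 2 state_cell) (RCell 6 (NConst 0))))
               (RNat (NConst 0)))
        [:: RSet 2 state_cell (RCell 6 (NConst 0)); NSet 1 state_cell (var 12)]
        [::]].

Definition state_backup := For 12 nA (action_estimate ++ action_update).
Definition stage_backup := For 11 nS state_backup.
Definition phase := copy_values ++ phase_sampling ++ For 13 nH stage_backup.

(** * Correctness and cost of one backward pass *)

Section Phase.
Variables (R : realType) (S A : finType) (M : mdp R S A).
Let H : nat := horizon M.
Local Notation rank t := (nat_of_ord (enum_rank t)).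
Implicit Types (c : config R) (s t : S) (a b : A).

Variable m2 : nat.

Definition environment c : Prop :=
  [/\ nmem c 0 0 = #|S|, nmem c 0 1 = #|A|, nmem c 0 2 = H,
      nmem c 8 0 = (H * m2)%N & nmem c 9 0 = m2] /\
  forall s a, rmem c 1 (rank s * #|A| + rank a)%N = reward M s a.

Lemma environment_unchanged xs ys c c' :
  all (fun x => x \notin xs) [:: 0; 8; 9]%N -> 1%N \notin ys ->
  unchanged xs ys c c' -> environment c -> environment c'.
Proof.
move=> /= /and4P[x0 x8 x9 _] y1 [n r] [[? ? ? ? ?] e2].
by split=> [|s a]; [split; rewrite n|rewrite r].
Qed.

Definition rows c x (h : nat) t : R := rmem c x (h * #|S| + rank t)%N.

(* When [good] is false nothing is claimed about the sampled values, the
   failure probabilities vanish and only the sure properties are left. *)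
Variable good : bool.
Variables (e l : nat) (u : R).
Hypotheses (e_gt1 : (1 < e)%N) (l_gt0 : (0 < l)%N).
Hypotheses (u_ge : e%:R^-1 <= u) (u_le : u <= H%:R).
Hypothesis m2_ge : (1 < H)%N ->
  128 * 128 * (H%:R / 2) * H%:R * l%:R * e%:R ^+ 2 <= m2%:R :> R.

Let al : R := alpha M e.
Let be : R := beta M e u.

Definition fail1 : R := if good then 2 * H%:R * expR (- ell R l) else 0.
Definition fail2 : R := if good then 2 * expR (- ell R l) else 0.

Lemma fail1_ge0 : 0 <= fail1.
Proof. by rewrite /fail1; case: good; rewrite ?mulr_ge0 ?expR_ge0. Qed.

Lemma fail2_ge0 : 0 <= fail2.
Proof. by rewrite /fail2; case: good; rewrite ?mulr_ge0 ?expR_ge0. Qed.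

Definition action_time := (m2 * 6 + H * m2 * 3 + 12)%N.

Section Previous.
Variable V0 : nat -> S -> R.
Hypothesis V0_close : good ->
  forall h t, (h <= H)%N -> `|V0 h t - optimal_value M h t| <= u.
Hypothesis V0_end : forall t, V0 H t = 0.

Definition sampled_block c s a : Prop := exists ts : seq S,
  [/\ size ts = (H * m2)%N, good -> chernoff1 M e l u V0 s a ts < 1 &
   forall j, (j < H * m2)%N ->
     nmem c 15 ((rank s * #|A| + rank a) * (H * m2) + j)%N =
     nth 0%N [seq rank t | t <- ts] j].

Lemma sum_sampled (F : nat -> R) (ts : seq S) n (g : nat -> nat) :
  size ts = n ->
  (forall j, (j < n)%N -> g j = nth 0%N [seq rank t | t <- ts] j) ->
  \sum_(j < n) F (g j) = \sum_(t <- ts) F (rank t).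
Proof.
move=> <- gE; rewrite -(big_map (fun t => rank t) predT F).
rewrite (big_nth 0%N) size_map big_mkord.
by apply: eq_bigr => j _; rewrite gE.
Qed.

Section Action.
Variables (c : config R) (s : S) (a : A) (h i : nat) (V1 : S -> R).
Hypotheses (c_env : environment c).
Hypotheses (c_s : nmem c 11 0 = rank s) (c_a : nmem c 12 0 = rank a).
Hypotheses (c_i : nmem c 13 0 = i) (i_lt : (i < H)%N) (hE : h.+1 = (H - i)%N).
Hypothesis c_block : sampled_block c s a.
Hypothesis c_V0 : forall t, rows c 3 h.+1 t = V0 h.+1 t.
Hypothesis c_V1 : forall t, rows c 2 h.+1 t = V1 t.
Hypothesis V1_close : good -> forall t, `|V1 t - optimal_value M h.+1 t| <= u.
Hypothesis V1_end : h.+1 = H -> forall t, V1 t = 0.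

(** Independence enters here: [V0] and [V1] are determined by [c], before the fresh samples are
    drawn, so [chernoff2] is a fixed function of these samples. The shared samples were already
    judged in [c_block]. *)
Lemma wp_action_estimate :
  wp M action_estimate c (m2 * 6 + H * m2 * 3 + 8) m2 fail2 (fun c' =>
    good -> `|reward M s a + rmem c' 4 0 / (H * m2)%:R + rmem c' 5 0 / m2%:R
              - qvalue M V1 s a| <= backup_error M al be h s a).
Proof.
have h_lt : (h < H)%N by rewrite hE leq_subr.
have [[cS cA cH c8 c9] cr] := c_env.
pose Phi ts := if good then chernoff2 M l u s a V1 (V0 h.+1) ts else 0.
have V12 : good -> forall t, `|V1 t - V0 h.+1 t| <= 2 * u.
  move=> g t; have := V1_close g t; have := V0_close g t h_lt.
  by rewrite !ler_norml; lra.
have Phi0 ts : 0 <= Phi ts by rewrite /Phi; case: good => //; exact: chernoff_ge0.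
have PhiS ts : mean M s a (fun t => Phi (rcons ts t)) <= Phi ts.
  rewrite /Phi; case g: good; last by rewrite mean_cst.
  apply: chernoff_supermartingale => [?|? ?|?].
  - exact: (lambda2_gt0 M e_gt1 u_ge).
  - exact: (chernoff2_bounded M e_gt1 u_ge _ _ (V12 g)).
  - exact: (chernoff2_variance M _ _ (V12 g)).
have -> : fail2 = Phi [::] + (0 + 0).
  rewrite /fail2 /Phi /chernoff2 !addr0; case: good => //.
  by rewrite chernoff_nil card_ord mulr1.
have -> : (m2 * 6 + H * m2 * 3 + 8 = (m2 * 3 + 2) + ((H * m2 * 3 + 3) + (m2 * 3 + 3)))%N.
  by lia.
rewrite -[X in wp _ _ _ _ X _ _]addn0 -[X in wp _ _ _ _ (_ + X)%N _ _]addn0.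
have W1 := @wp_sample_for R S A M 16%N 14%N (var 9) (NConst 0) (var 11) (var 12)
  c m2 0%N s a Phi isT Phi0 PhiS.
apply: wp_cat (W1 _) _; first by rewrite addr0.
  by move=> c' f; split; rewrite //= f.1.
move=> c1 f1 [_ [ts2 [sz2 P2 nth2]]].
have [ts1 [sz1 P1 nth1]] := c_block.
pose g1 j := rmem c 3 (h.+1 * #|S|
  + nmem c 15 ((rank s * #|A| + rank a) * (H * m2) + j))%N.
pose g2 j := rmem c 2 (h.+1 * #|S| + nmem c1 16 j)%N
  - rmem c 3 (h.+1 * #|S| + nmem c1 16 j)%N.
have W2 := @wp_sum_for R S A M 4%N 14%N (var 8)
  (next_value 3 (NCell 15 (NAdd block (var 14)))) c1 (H * m2) g1.
apply: wp_cat (W2 _ _) _ => //.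
- by move=> c' f; rewrite /= f.1 // f1.1.
- move=> j c' jm f cj; rewrite /= cj !(f.1, f.2) // !(f1.1, f1.2) //.
  by rewrite cS cA cH c8 c_s c_a c_i -hE.
move=> c2 f2 sum1.
have W3 := @wp_sum_for R S A M 5%N 14%N (var 9)
  (RSub (next_value 2 (NCell 16 (var 14))) (next_value 3 (NCell 16 (var 14))))
  c2 m2 g2.
apply: wp_weaken (W3 _ _) _ _ _ _ => //.
- by move=> c' f; rewrite /= f.1 // f2.1 // f1.1.
- move=> j c' jm f cj; rewrite /= cj !(f.1, f.2) // !(f2.1, f2.2) //.
  by rewrite !(f1.1 0%N, f1.1 13%N) // !f1.2 // cS cH c_i -hE.
move=> c3 f3 sum2 g.
rewrite sum2 f3.2 // sum1.
rewrite (sum_sampled (fun k => rmem c 3 (h.+1 * #|S| + k)%N) sz1 nth1).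
rewrite (sum_sampled (fun k => rmem c 2 (h.+1 * #|S| + k)%N
  - rmem c 3 (h.+1 * #|S| + k)%N) sz2 nth2).
under eq_bigr do rewrite -/(rows c 3 h.+1 _) c_V0.
under [X in _ + X / m2%:R]eq_bigr do
  rewrite -/(rows c 2 h.+1 _) -/(rows c 3 h.+1 _) c_V0 c_V1.
apply: (estimate_error e_gt1 l_gt0 u_ge u_le m2_ge (V0_close g)) => //.
- exact: V1_close.
- by move=> hH t; rewrite V1_end // hH V0_end.
- exact: P1.
- by move: P2; rewrite /Phi g.
Qed.

Lemma wp_action :
  let cell := (h * #|S| + rank s)%N in
  wp M (action_estimate ++ action_update) c action_time m2 fail2
    (fun c' => exists q,
      (good -> `|q - qvalue M V1 s a| <= backup_error M al be h s a) /\
      let upd := (rank a == 0)%N || (rmem c 2 cell <= q) in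
      forall j,
        rmem c' 2 j = (if upd && (j == cell) then q else rmem c 2 j) /\
        nmem c' 1 j = (if upd && (j == cell) then rank a else nmem c 1 j)).
Proof.
move=> cell; have [[cS cA cH c8 c9] cr] := c_env.
rewrite -[fail2]addr0 -[X in wp _ _ _ _ X _ _]addn0.
have -> : (action_time = (m2 * 6 + H * m2 * 3 + 8) + 4)%N.
  by rewrite /action_time; lia.
apply: wp_cat wp_action_estimate _ => // c1 f1 hq.
apply: wp_rset; apply: wp_if; rewrite [reval _ _]/=.
set q := _ + _ + _.
have cellE : ((H - (i + 1)) * #|S| + rank s)%N = cell.
  by rewrite /cell; congr (_ * _ + _)%N; move: hE; lia.
have {}hq : good -> `|q - qvalue M V1 s a| <= backup_error M al be h s a.
  move=> g; move: (hq g); rewrite /q.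
  by rewrite !f1.1 // (f1.2 1%N) // cA c_s c_a c8 c9 cr.
clearbody q => /=.
rewrite /update /= !f1.1 // (f1.2 2%N) // cS cH c_s c_a c_i cellE.
have -> : ((rank a)%:R * (rmem c 2 cell - q) <= 0%:R) =
    (rank a == 0)%N || (rmem c 2 cell <= q).
  case: (posnP (rank a)) => [->|a0]; first by rewrite mul0r lexx.
  by rewrite pmulr_rle0 ?ltr0n // subr_le0.
case: ifP => upd; last first.
  have W : wp M [::] (setr c1 6 0 q) 0 0 0 (fun=> True) by apply: wp_nil.
  by apply: wp_weaken W _ _ _ _ => // c2 f2 _; exists q; split=> // j;
    rewrite upd f2.1 // f2.2 //= /update /= f1.1 // f1.2.
apply: wp_rset; apply: wp_nset; apply: wp_nil.
exists q; split=> // j; rewrite upd /= /update /=.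
rewrite !f1.1 // ?f1.2 // cS cH c_s c_a c_i cellE.
by [].
Qed.

End Action.
Definition chosen c h V1 s : Prop := exists a,
  nmem c 1 (h * #|S| + rank s)%N = rank a /\
  (good -> let v := rows c 2 h s in
    `|v - qvalue M V1 s a| <= backup_error M al be h s a /\
    forall b, qvalue M V1 s b - backup_error M al be h s b <= v).

Lemma sampled_block_frame p c1 c2 s a :
  15%N \notin nwritten p -> frame p c1 c2 ->
  sampled_block c1 s a -> sampled_block c2 s a.
Proof.
move=> p15 f [ts [? ? nts]]; exists ts; split=> // j jm.
by rewrite f.1 // nts.
Qed.

Lemma chosen_eq c1 c2 h V1 s :
  nmem c2 1 (h * #|S| + rank s)%N = nmem c1 1 (h * #|S| + rank s)%N ->
  rows c2 2 h s = rows c1 2 h s -> chosen c1 h V1 s -> chosen c2 h V1 s.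
Proof. by move=> n r [a [na ha]]; exists a; rewrite n r. Qed.

Section Stage.
Variables (h i : nat) (V1 : S -> R).
Hypotheses (i_lt : (i < H)%N) (hE : h.+1 = (H - i)%N).
Hypothesis V1_close : good -> forall t, `|V1 t - optimal_value M h.+1 t| <= u.
Hypothesis V1_end : h.+1 = H -> forall t, V1 t = 0.

Definition stage_start c : Prop :=
  [/\ environment c, nmem c 13 0 = i, forall s a, sampled_block c s a,
      forall t, rows c 3 h.+1 t = V0 h.+1 t & forall t, rows c 2 h.+1 t = V1 t].

Lemma wp_state_backup c s : stage_start c -> nmem c 11 0 = rank s ->
  let cell := (h * #|S| + rank s)%N in
  wp M state_backup c (#|A| * action_time.+2 + 2) (#|A| * m2) (#|A|%:R * fail2)
    (fun c' => chosen c' h V1 s /\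
      forall j, j != cell -> rmem c' 2 j = rmem c 2 j /\ nmem c' 1 j = nmem c 1 j).
Proof.
move=> [c_env c_i c_block c_V0 c_V1] c_s cell.
have c_A : nmem c 0 1 = #|A| by case: c_env => [[]].
pose qv b := qvalue M V1 s b; pose err := backup_error M al be h s.
(* The cell holds a running maximum, of which only two consequences are kept: closeness to the
   recorded action and domination of the actions treated so far. Before action 0 it still holds the
   value of the previous pass, hence the guard [0 < k]. *)
pose I k (c' : config R) :=
  [/\ forall j, j != cell ->
        rmem c' 2 j = rmem c 2 j /\ nmem c' 1 j = nmem c 1 j,
      (0 < k)%N -> exists a, nmem c' 1 cell = rank a /\
        (good -> `|rmem c' 2 cell - qv a| <= err a)
    & good -> forall b, (rank b < k)%N -> qv b - err b <= rmem c' 2 cell].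
have I0 : I 0%N (setn c 12 0 0) by split.
have hbody k c' : (k < #|A|)%N -> frame state_backup c c' ->
    nmem c' 12 0 = k -> I k c' ->
    wp M (action_estimate ++ action_update) c' action_time m2 fail2
      (fun c2 => I k.+1 (setn c2 12 0 k.+1)).
  move=> kA f ck [Iu Ia Ib]; pose a : A := enum_val (Ordinal kA).
  have ra : rank a = k by rewrite enum_valK.
  have env' : environment c' by apply: environment_unchanged f c_env.
  have V1' t : rows c' 2 h.+1 t = V1 t.
    have jc : (h.+1 * #|S| + rank t != cell)%N.
      rewrite gtn_eqF // mulSn [X in (_ < X + _)%N]addnC -addnA ltn_add2l.
      by rewrite ltn_addr.
    by rewrite -c_V1; case: (Iu _ jc).
  have W := wp_action env' (s := s) (a := a) _ _ _ i_lt hE _ _ V1' V1_close V1_end.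
  apply: wp_weaken (W _ _ _ _ _) _ _ _ _ => //; rewrite ?ck ?ra ?f.1 //.
  - by apply: sampled_block_frame f (c_block s a).
  - by move=> t; rewrite /rows f.2 // -c_V0.
  move=> c2 f2 [q [hq]]; rewrite -/cell => hu; split; rewrite /= /update /=.
  - move=> j jc; have [-> ->] := hu j.
    by rewrite (negbTE jc) andbF; exact: Iu.
  - move=> _; have [] := hu cell; rewrite eqxx andbT => -> ->.
    case: ifP => [_|/negbT]; first by exists a; rewrite ra.
    by rewrite negb_or => /andP[k0 _]; apply: Ia; rewrite lt0n.
  - move=> g b; rewrite ltnS leq_eqVlt => bk.
    have [-> _] := hu cell; rewrite eqxx andbT.
    have {hq}/= := hq g; rewrite -/(qv a) -/(err a) ler_norml => /andP[hq1 hq2].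
    case/orP: bk => [/eqP bk|bk].
      have -> : b = a by apply: enum_rank_inj; apply: val_inj; rewrite /= ra.
      case: ifP => [_|/negbT]; first by lra.
      by rewrite negb_or -ltNge => /andP[_]; lra.
    have {}Ib := Ib g b bk; case: ifP => // /orP[/eqP k0|]; last by lra.
    by move: bk; rewrite k0.
have xb : 12%N \notin nwritten (action_estimate ++ action_update) by [].
have en c' : frame state_backup c c' -> neval c' nA = #|A|.
  by move=> f; rewrite /= f.1.
have W := wp_for fail2_ge0 xb en I0 hbody.
apply: wp_weaken W _ _ _ _ => // c' f [Iu Ia Ib]; split=> //.
have [|b [Nb Qb]] := Ia _; first exact: actions_gt0 M.
exists b; split=> // g; split; first exact: Qb.
by move=> d; apply: Ib => //; exact: ltn_ord.
Qed.

Definition state_time := (#|A| * action_time.+2 + 2)%N.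

Lemma wp_stage_backup c : stage_start c ->
  wp M stage_backup c (#|S| * state_time.+2 + 2) (#|S| * (#|A| * m2))
    (#|S|%:R * (#|A|%:R * fail2))
    (fun c' => (forall s, chosen c' h V1 s) /\
      forall j, (h.+1 * #|S| <= j)%N ->
        rmem c' 2 j = rmem c 2 j /\ nmem c' 1 j = nmem c 1 j).
Proof.
move=> [c_env c_i c_block c_V0 c_V1].
have c_S : nmem c 0 0 = #|S| by case: c_env => [[]].
pose I k (c' : config R) := (forall s, (rank s < k)%N -> chosen c' h V1 s) /\
  forall j, (j < h * #|S|)%N || (h * #|S| + k <= j)%N ->
    rmem c' 2 j = rmem c 2 j /\ nmem c' 1 j = nmem c 1 j.
have I0 : I 0%N (setn c 11 0 0) by split.
have hbody k c' : (k < #|S|)%N -> frame stage_backup c c' ->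
    nmem c' 11 0 = k -> I k c' ->
    wp M state_backup c' state_time (#|A| * m2) (#|A|%:R * fail2)
      (fun c2 => I k.+1 (setn c2 11 0 k.+1)).
  move=> kS f ck [Is Iu]; pose s : S := enum_val (Ordinal kS).
  have rs : rank s = k by rewrite enum_valK.
  have start' : stage_start c'.
    split=> [||s' a|t|t].
    - by apply: environment_unchanged f c_env.
    - by rewrite f.1.
    - by apply: sampled_block_frame f (c_block s' a).
    - by rewrite /rows f.2 // -c_V0.
    rewrite -c_V1; case: (Iu (h.+1 * #|S| + rank t)%N) => //.
    by rewrite mulSn [(#|S| + _)%N]addnC -addnA leq_add2l orbC ltnW // ltn_addr.
  have W := wp_state_backup start' (etrans ck (esym rs)).
  apply: wp_weaken W _ _ _ _ => // c2 f2 [new old].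
  split=> [s' |j jk]; rewrite /= /update /=.
    rewrite ltnS leq_eqVlt => /orP[/eqP sk|sk].
      by have -> : s' = s by apply: enum_rank_inj; apply: val_inj; rewrite /= rs.
    have [|e2 e1] := old (h * #|S| + rank s')%N.
      by rewrite rs eqn_add2l ltn_eqF.
    exact: chosen_eq e1 e2 (Is _ sk).
  have jc : j != (h * #|S| + rank s)%N.
    by apply: contraTneq jk => ->; rewrite rs negb_or -leqNgt leq_addr addnS ltnn.
  have [-> ->] := old j jc; apply: Iu.
  by case/orP: jk => [->//|jk]; apply/orP; right; apply: leq_trans jk; rewrite addnS.
have xb : 11%N \notin nwritten state_backup by [].
have en c' : frame stage_backup c c' -> neval c' nS = #|S|.
  by move=> f; rewrite /= f.1.
have e0 : 0 <= #|A|%:R * fail2 by rewrite mulr_ge0 ?fail2_ge0.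
have W := wp_for e0 xb en I0 hbody.
apply: wp_weaken W _ _ _ _ => // c' f [Is Iu]; split=> [s|j jh].
  exact: Is.
by apply: Iu; rewrite -mulSnr jh orbT.
Qed.

End Stage.

Definition stage_time := (#|S| * state_time.+2 + 2)%N.

Definition values_chosen c := forall h s, (h < H)%N ->
  chosen c h (rows c 2 h.+1) s.

Lemma chosen_close c h0 : good -> (h0 <= H)%N ->
  (forall t, rows c 2 H t = 0) ->
  (forall h s, (h0 <= h < H)%N -> chosen c h (rows c 2 h.+1) s) ->
  forall h t, (h0 <= h <= H)%N -> `|rows c 2 h t - optimal_value M h t|
    <= value_error M al be h t.
Proof.
move=> g h0H cend ch.
apply: (approximate_iteration_value (alpha_ge0 M e_gt1) (beta_ge0 M e_gt1 u_ge) cend).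
by move=> h s hh; have [a [_ /(_ g) ha]] := ch h s hh; exists a.
Qed.

Lemma error_le_quarter h t : value_error M al be h t <= u / 4.
Proof.
apply: le_trans (total_error_le M e_gt1 u_ge).
by apply: value_error_le; [exact: alpha_ge0|exact: (beta_ge0 M e_gt1 u_ge)].
Qed.

Lemma wp_stages c : environment c ->
  (forall s a, sampled_block c s a) ->
  (forall h t, (h <= H)%N -> rows c 3 h t = V0 h t) ->
  (forall t, rows c 2 H t = 0) ->
  wp M (For 13 nH stage_backup) c (H * stage_time.+2 + 2)
    (H * (#|S| * (#|A| * m2))) (H%:R * (#|S|%:R * (#|A|%:R * fail2)))
    (fun c' => (forall t, rows c' 2 H t = 0) /\ values_chosen c').
Proof.
move=> c_env c_block c_V0 c_end.
have c_H : nmem c 0 2 = H by case: c_env => [[]].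
pose I i (c' : config R) := (forall t, rows c' 2 H t = 0) /\
  forall h s, (H - i <= h < H)%N -> chosen c' h (rows c' 2 h.+1) s.
have I0 : I 0%N (setn c 13 0 0).
  by split=> // h s; rewrite subn0 => /andP[Hh hH]; move: hH; rewrite ltnNge Hh.
have hbody i c' : (i < H)%N -> frame (For 13 nH stage_backup) c c' ->
    nmem c' 13 0 = i -> I i c' ->
    wp M stage_backup c' stage_time (#|S| * (#|A| * m2))
      (#|S|%:R * (#|A|%:R * fail2)) (fun c2 => I i.+1 (setn c2 13 0 i.+1)).
  move=> iH f ci [Iend Ich].
  have hE : (H - i.+1).+1 = (H - i)%N by rewrite subnSK.
  set h := (H - i.+1)%N in hE.
  have hH : (h.+1 <= H)%N by rewrite hE leq_subr.
  (* The rows already rewritten in this pass are within [u / 4] of the optimal values, which is more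
     than the concentration bound of the present stage requires. *)
  have V1c : good -> forall t,
      `|rows c' 2 h.+1 t - optimal_value M h.+1 t| <= u.
    move=> g t; apply: (@le_trans _ _ (u / 4)).
      apply: le_trans (error_le_quarter h.+1 t).
      by apply: chosen_close (H - i)%N _ _ _ _ _ _ _ => //; rewrite -?hE ?leqnn.
    by have := scale_gt0 e_gt1 u_ge; lra.
  have V1e : h.+1 = H -> forall t, rows c' 2 h.+1 t = 0 by move=> ->.
  have start' : stage_start h i (rows c' 2 h.+1) c'.
    split=> // [|s a|t].
    - by apply: environment_unchanged f c_env.
    - by apply: sampled_block_frame f (c_block s a).
    - by rewrite /rows f.2 // -c_V0.
  have W := wp_stage_backup iH hE V1c V1e start'.
  apply: wp_weaken W _ _ _ _ => // c2 f2 [new old].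
  have oldr h' t : (h < h')%N -> rows c2 2 h' t = rows c' 2 h' t.
    move=> hh; case: (old (h' * #|S| + rank t)%N) => //.
    by rewrite (leq_trans _ (leq_addr _ _)) // leq_mul2r hh orbT.
  split=> [t|h' s hh']; first by rewrite -(Iend t) -oldr.
  rewrite -[chosen _ _ _ _]/(chosen c2 h' (rows c2 2 h'.+1) s).
  have -> : rows c2 2 h'.+1 = rows c' 2 h'.+1.
    by apply: funext => t; apply: oldr; rewrite ltnS; case/andP: hh'.
  move: (hh') => /andP[]; rewrite -/h leq_eqVlt => /orP[/eqP <- //|lt_hh'] h'H.
  apply: chosen_eq (Ich h' s _); last by rewrite -hE lt_hh'.
    case: (old (h' * #|S| + rank s)%N) => //.
    by rewrite (leq_trans _ (leq_addr _ _)) // leq_mul2r lt_hh' orbT.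
  exact: oldr.
have xb : 13%N \notin nwritten stage_backup by [].
have en c' : frame (For 13 nH stage_backup) c c' -> neval c' nH = H.
  by move=> f; rewrite /= f.1.
have e0 : 0 <= #|S|%:R * (#|A|%:R * fail2) by rewrite !mulr_ge0 ?fail2_ge0.
have W := wp_for e0 xb en I0 hbody.
apply: wp_weaken W _ _ _ _ => // c' f [Iend Ich]; split=> // h s hH.
by apply: Ich; rewrite subnn.
Qed.

Lemma wp_phase_sampling c : environment c ->
  wp M phase_sampling c (#|S| * (#|A| * (H * m2 * 3 + 2).+2 + 2).+2 + 2)
    (#|S| * (#|A| * (H * m2))) (#|S|%:R * (#|A|%:R * fail1))
    (fun c' => forall s a, sampled_block c' s a).
Proof.
move=> c_env; have [[cS cA cH c8 c9] cr] := c_env.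
(* Pairs are counted by their rank in lexicographic order, which is also the position of their block
   in array 15; both nested loops share this invariant. *)
pose J k (c' : config R) :=
  forall s a, (rank s * #|A| + rank a < k)%N -> sampled_block c' s a.
pose pair_sampling := SampleFor 15 14 (var 8) block (var 11) (var 12).
have step s a c' : environment c' -> nmem c' 11 0 = rank s ->
    nmem c' 12 0 = rank a -> J (rank s * #|A| + rank a)%N c' ->
    wp M pair_sampling c' (H * m2 * 3 + 2) (H * m2) fail1
      (J (rank s * #|A| + rank a).+1).
  move=> [[eS eA eH e8 e9] er] es ea Jc.
  pose Phi ts := if good then chernoff1 M e l u V0 s a ts else 0.
  have Phi0 ts : 0 <= Phi ts.
    by rewrite /Phi; case: good => //; exact: chernoff_ge0.
  have PhiS ts : mean M s a (fun t => Phi (rcons ts t)) <= Phi ts.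
    rewrite /Phi; case g: good; last by rewrite mean_cst.
    apply: chernoff_supermartingale => [?|? ?|?].
    - exact: (lambda1_gt0 M e_gt1).
    - exact: (chernoff1_bounded e_gt1 u_le (V0_close g)).
    - exact: (chernoff1_variance (V0_close g)).
  have -> : fail1 = Phi [::].
    rewrite /fail1 /Phi /chernoff1; case: good => //.
    by rewrite chernoff_nil card_ord.
  have W := @wp_sample_for R S A M 15%N 14%N (var 8) block (var 11) (var 12)
    c' (H * m2)%N ((rank s * #|A| + rank a) * (H * m2))%N s a Phi isT Phi0 PhiS.
  apply: wp_weaken (W _) _ _ _ _ => //.
    by move=> c2 f; split; rewrite /= !f.1 //= ?eA ?e8 ?es ?ea.
  move=> c2 f [old [ts [sz P nts]]] s' a'.
  rewrite ltnS leq_eqVlt => /orP[/eqP idx|idx].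
    have rsE : rank s' = rank s.
      have := congr1 (fun k => k %/ #|A|)%N idx.
      by rewrite !divnMDl ?(actions_gt0 M) // !divn_small // !addn0.
    have raE : rank a' = rank a.
      by move: idx; rewrite rsE => /addnI.
    exists ts; split=> // [g|j jm]; last by rewrite idx nts.
    have -> : s' = s by apply: enum_rank_inj; exact: val_inj.
    have -> : a' = a by apply: enum_rank_inj; exact: val_inj.
    by move: P; rewrite /Phi g.
  have [ts' [sz' P' nts']] := Jc s' a' idx; exists ts'; split=> // j jm.
  rewrite old ?nts' //; apply/orP; left.
  apply: (@leq_trans ((rank s' * #|A| + rank a').+1 * (H * m2))).
    by rewrite mulSn addnC ltn_add2r.
  by rewrite leq_mul2r idx orbT.
have e1 := fail1_ge0.
pose IA s k := J (rank s * #|A| + k)%N.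
have inner s c' : environment c' -> nmem c' 11 0 = rank s ->
    J (rank s * #|A|)%N c' ->
    wp M (For 12 nA pair_sampling) c' (#|A| * (H * m2 * 3 + 2).+2 + 2)
      (#|A| * (H * m2)) (#|A|%:R * fail1) (J ((rank s).+1 * #|A|)%N).
  move=> env' es Jc.
  have I0 : IA s 0%N (setn c' 12 0 0) by rewrite /IA addn0.
  have hbody k c2 : (k < #|A|)%N -> frame (For 12 nA pair_sampling) c' c2 ->
      nmem c2 12 0 = k -> IA s k c2 ->
      wp M pair_sampling c2 (H * m2 * 3 + 2) (H * m2) fail1
        (fun c3 => IA s k.+1 (setn c3 12 0 k.+1)).
    move=> kA f ck Ik; pose a : A := enum_val (Ordinal kA).
    have ra : rank a = k by rewrite enum_valK.
    have env2 : environment c2 by apply: environment_unchanged f env'.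
    have s2 : nmem c2 11 0 = rank s by rewrite f.1.
    have W := step s a c2 env2 s2 (etrans ck (esym ra)).
    rewrite ra in W; apply: wp_weaken (W Ik) _ _ _ _ => // c3 _.
    by rewrite /IA addnS.
  have xb : 12%N \notin nwritten pair_sampling by [].
  have en c2 : frame (For 12 nA pair_sampling) c' c2 -> neval c2 nA = #|A|.
    by move=> f; rewrite /= f.1 //; case: env' => [[]].
  have W := wp_for e1 xb en I0 hbody.
  by apply: wp_weaken W _ _ _ _ => // c2 _; rewrite /IA -mulSnr.
pose IS k := J (k * #|A|)%N.
have I0 : IS 0%N (setn c 11 0 0) by [].
have hbody k c2 : (k < #|S|)%N -> frame phase_sampling c c2 ->
    nmem c2 11 0 = k -> IS k c2 ->
    wp M (For 12 nA pair_sampling) c2 (#|A| * (H * m2 * 3 + 2).+2 + 2)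
      (#|A| * (H * m2)) (#|A|%:R * fail1)
      (fun c3 => IS k.+1 (setn c3 11 0 k.+1)).
  move=> kS f ck Ik; pose s : S := enum_val (Ordinal kS).
  have rs : rank s = k by rewrite enum_valK.
  have env2 : environment c2 by apply: environment_unchanged f c_env.
  have W := inner s c2 env2 (etrans ck (esym rs)); rewrite rs in W.
  by apply: wp_weaken (W Ik) _ _ _ _.
have xb : 11%N \notin nwritten (For 12 nA pair_sampling) by [].
have en c2 : frame phase_sampling c c2 -> neval c2 nS = #|S|.
  by move=> f; rewrite /= f.1.
have e2 : 0 <= #|A|%:R * fail1 by rewrite mulr_ge0.
have W := wp_for e2 xb en I0 hbody.
apply: wp_weaken W _ _ _ _ => // c' f Ic s a; apply: Ic.
apply: (@leq_trans ((rank s).+1 * #|A|)).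
  by rewrite mulSn addnC ltn_add2r.
by rewrite leq_mul2r ltn_ord orbT.
Qed.

End Previous.
Lemma wp_copy_values c : environment c ->
  wp M copy_values c ((H + 1) * #|S| * 3 + 2) 0 0
    (fun c' => forall j, (j < (H + 1) * #|S|)%N -> rmem c' 3 j = rmem c 2 j).
Proof.
move=> [[cS cA cH _ _] _].
pose I k (c' : config R) := forall j, (j < k)%N -> rmem c' 3 j = rmem c 2 j.
have I0 : I 0%N (setn c 14 0 0) by [].
have hbody k c' : (k < (H + 1) * #|S|)%N -> frame copy_values c c' ->
    nmem c' 14 0 = k -> I k c' ->
    wp M [:: RSet 3 (var 14) (RCell 2 (var 14))] c' 1 0 0
      (fun c2 => I k.+1 (setn c2 14 0 k.+1)).
  move=> _ f ck Ik; apply: wp_rset; apply: wp_nil => j.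
  rewrite ltnS leq_eqVlt /= /update /= ck => /orP[/eqP ->|jk].
    by rewrite eqxx f.2.
  by rewrite (ltn_eqF jk) Ik.
have xb : 14%N \notin nwritten [:: RSet 3 (var 14) (RCell 2 (var 14))] by [].
have en c' : frame copy_values c c' ->
    neval c' (NMul (NAdd nH (NConst 1)) nS) = ((H + 1) * #|S|)%N.
  by move=> f; rewrite /= !f.1 // cH cS.
have W := wp_for (lexx (0 : R)) xb en I0 hbody.
by apply: wp_weaken W _ _ _ _; rewrite ?muln0 ?mulr0.
Qed.

Definition phase_time :=
  ((H + 1) * #|S| * 3 + 2 +
   (#|S| * (#|A| * (H * m2 * 3 + 2).+2 + 2).+2 + 2 +
    (H * stage_time.+2 + 2)))%N.

Definition phase_calls :=
  (#|S| * (#|A| * (H * m2)) + H * (#|S| * (#|A| * m2)))%N.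

Definition phase_fail : R :=
  #|S|%:R * (#|A|%:R * fail1) + H%:R * (#|S|%:R * (#|A|%:R * fail2)).

Lemma phase_fail_ge0 : 0 <= phase_fail.
Proof.
by rewrite addr_ge0 // !mulr_ge0 // (fail1_ge0, fail2_ge0).
Qed.

(** A policy is present in memory whether [good] holds or not: this yields the output with
    probability 1. Only its accuracy and that of the values depend on the flag. *)
Definition phase_invariant (w : R) c : Prop :=
  [/\ environment c, forall t, rows c 2 H t = 0 &
    exists pi : policy M, outputs c pi /\ (good ->
      (forall h t, (h <= H)%N -> `|rows c 2 h t - optimal_value M h t| <= w) /\
      (forall h t, (h <= H)%N ->
        optimal_value M h t - w <= policy_value pi h t))].

Lemma wp_phase c : phase_invariant u c ->
  wp M phase c phase_time phase_calls phase_fail (phase_invariant (u / 2)).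
Proof.
move=> [c_env c_end [pi0 [out0 close0]]].
have f1 := fail1_ge0; have f2 := fail2_ge0.
rewrite -[phase_calls]add0n -[phase_fail]add0r.
apply: wp_cat (wp_copy_values c_env) _; first exact: phase_fail_ge0.
move=> c1 fr1 copied.
have V0c : good -> forall h t, (h <= H)%N ->
    `|rows c 2 h t - optimal_value M h t| <= u.
  by move=> /close0[].
have env1 : environment c1 by apply: environment_unchanged fr1 c_env.
apply: wp_cat (wp_phase_sampling V0c env1) _; first by rewrite !mulr_ge0.
move=> c2 fr2 blocks.
have env2 : environment c2 by apply: environment_unchanged fr2 env1.
have row_lt h t : (h <= H)%N -> (h * #|S| + rank t < (H + 1) * #|S|)%N.
  move=> hH; rewrite addn1; apply: (@leq_trans (h.+1 * #|S|)).
    by rewrite mulSn addnC ltn_add2r.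
  by rewrite leq_mul2r ltnS hH orbT.
have V0E h t : (h <= H)%N -> rows c2 3 h t = rows c 2 h t.
  by move=> hH; rewrite /rows fr2.2 // copied // row_lt.
have end2 t : rows c2 2 H t = 0 by rewrite -(c_end t) /rows fr2.2 // fr1.2.
apply: wp_weaken (wp_stages V0c c_end env2 blocks V0E end2) _ _ _ _ => //.
move=> c3 fr3 [end3 ch3]; split=> //.
  by apply: environment_unchanged fr3 env2.
have [pi piP] : exists pi : policy M, forall s (h : 'I_H), exists a,
    [/\ nmem c3 1 (h * #|S| + rank s)%N = rank a, pi (s, h) = a &
     good -> approximate_backup M al be (rows c3 2) h s a].
  (* The policy is recovered by choice from the ranks in array 1, together with the greedy property
     of each action. *)
  pose P (sh : S * 'I_H) a := nmem c3 1 (sh.2 * #|S| + rank sh.1)%N = rank a /\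
    (good -> approximate_backup M al be (rows c3 2) sh.2 sh.1 a).
  have /boolp.choice[pi piP] : forall sh, exists a, P sh a.
    move=> [s h]; have [a [na ha]] := ch3 h s (ltn_ord h).
    by exists a.
  by exists pi => s h; exists (pi (s, h)); have [] := piP (s, h).
have approx : good -> forall s (h : 'I_H),
    approximate_backup M al be (rows c3 2) h s (pi (s, h)).
  by move=> g s h; have [a [_ -> ap]] := piP s h; exact: ap.
have u0 := scale_gt0 e_gt1 u_ge.
exists pi; split=> [s h|g]; first by have [a [-> -> _]] := piP s h.
split=> h t hH; have q := error_le_quarter h t.
  have : `|rows c3 2 h t - optimal_value M h t| <= value_error M al be h t.
    by apply: (chosen_close (h0 := 0) g) => // h' s /andP[_]; exact: ch3.
  by lra.
have := @approximate_iteration_policy _ _ _ _ _ _ (rows c3 2)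
  (alpha_ge0 M e_gt1) (beta_ge0 M e_gt1 u_ge) end3 _ (approx g) h t hH.
by rewrite -/al -/be; lra.
Qed.

End Phase.

Definition parameters :=
  Doubling 2 7 (RNat (NConst 1)) (RCell 0 (NConst 0)) ++
  Doubling 4 3 (RNat (NMul (NMul (NMul nH nS) nA) (var 2))) (RCell 0 (NConst 1)) ++
  Doubling 6 5 (RNat (NMul nH (var 2))) (RNat (NConst 1)) ++
  [:: NSet 9 (NConst 0) (NMul (NMul (NMul (NMul (NMul (NMul (NConst 128)
        (NConst 128)) (NSub nH (NConst 1))) nH) (var 3)) (var 2)) (var 2));
      NSet 8 (NConst 0) (NMul nH (var 9))].

Definition program := parameters ++ For 10 (var 5) phase.

Lemma nth_allpairs (T1 T2 T : Type) (f : T1 -> T2 -> T) s t x1 x2 x i j :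
  (i < size s)%N -> (j < size t)%N ->
  nth x [seq f y z | y <- s, z <- t] (i * size t + j) = f (nth x1 s i) (nth x2 t j).
Proof.
move=> + jt; elim: s i => [|y s IH] [|i] //= it.
  by rewrite nth_cat size_map jt (nth_map x2).
by rewrite nth_cat size_map mulSn -addnA ltnNge leq_addr addKn IH.
Qed.

(** * The complete program: parameters and repeated passes *)

Section Program.
Variables (R : realType) (S A : finType) (M : mdp R S A) (eps delta : R).
Let H : nat := horizon M.
Variables (ke l K : nat).
Let e := (2 ^ ke)%N.
Hypotheses (ke_le : 1 <= eps * e%:R)
  (ke_min : forall j, (j < ke)%N -> eps * (2 ^ j)%:R < 1).
Hypotheses (l_le : (H * #|S| * #|A| * e)%:R <= delta * (2 ^ l)%:R)
  (l_min : forall j, (j < l)%N -> delta * (2 ^ j)%:R < (H * #|S| * #|A| * e)%:R).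
Hypotheses (K_le : (H * e)%:R <= 1 * (2 ^ K)%:R :> R)
  (K_min : forall j, (j < K)%N -> 1 * (2 ^ j)%:R < (H * e)%:R :> R).
Hypotheses (ke_gt0 : (0 < ke)%N) (l_gt0 : (0 < l)%N).

Let m2 := stage_samples H l e.
Variable good : bool.

Definition program_time :=
  (ke * 3 + 3 + (l * 3 + 3 + (K * 3 + 3 + (2 +
    (K * (phase_time M m2).+2 + 2)))))%N.

Lemma wp_program :
  wp M program (start M program eps delta) program_time (K * phase_calls M m2)
    (K%:R * phase_fail M good l)
    (phase_invariant M m2 good (H%:R / (2 ^ K)%:R)).
Proof.
set c := start _ _ _ _.
have e_gt1 : (1 < e)%N by rewrite /e -{1}(expn0 2) ltn_exp2l.
rewrite -[(K * phase_calls _ _)%N]add0n -[_ * phase_fail _ _ _]add0r.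
rewrite /program /parameters -!catA.
have fail0 : 0 <= K%:R * phase_fail M good l.
  by rewrite mulr_ge0 ?phase_fail_ge0.
have W1 := @wp_doubling R S A M 2%N 7%N (RNat (NConst 1)) (RCell 0 (NConst 0))
  c 1 eps ke isT.
apply: wp_cat (W1 _ ke_le ke_min) _ => //.
  by move=> c' f; rewrite /= f.2 //.
move=> c1 f1 [c1e _].
rewrite -[(K * phase_calls _ _)%N]add0n -[_ * phase_fail _ _ _]add0r.
have W2 := @wp_doubling R S A M 4%N 3%N
  (RNat (NMul (NMul (NMul nH nS) nA) (var 2))) (RCell 0 (NConst 1))
  c1 (H * #|S| * #|A| * e)%:R delta l isT.
apply: wp_cat (W2 _ l_le l_min) _ => //.
  by move=> c' f; rewrite /= f.2 // f1.2 // !f.1 // c1e !f1.1 //=.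
move=> c2 f2 [_ c2l].
rewrite -[(K * phase_calls _ _)%N]add0n -[_ * phase_fail _ _ _]add0r.
have W3 := @wp_doubling R S A M 6%N 5%N
  (RNat (NMul nH (var 2))) (RNat (NConst 1)) c2 (H * e)%:R 1 K isT.
apply: wp_cat (W3 _ K_le K_min) _ => //.
  by move=> c' f; rewrite /= !f.1 // !f2.1 // c1e f1.1.
move=> c3 f3 [_ c3K].
rewrite /cat -/(cat _ _) add2n; apply: wp_nset; apply: wp_nset.
set c5 := setn _ _ _ _.
have env : environment M m2 c5.
  split=> [|s a].
    by split; rewrite /= /update /= !f3.1 // ?c2l !f2.1 // ?c1e !f1.1.
  rewrite /= f3.2 // f2.2 // f1.2 //= /input_rmem /=.
  have -> : (enum_rank s * #|A| + enum_rank a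
      = enum_rank s * size (enum A) + enum_rank a)%N by rewrite -cardE.
  by rewrite (nth_allpairs _ s a) ?nth_enum_rank // -cardE ltn_ord.
have e0 : 0 < e%:R :> R by rewrite ltr0n ltnW.
pose I j := phase_invariant M m2 good (H%:R / (2 ^ j)%:R).
have I0 : I 0%N (setn c5 10 0 0).
  split=> // [t|].
    by rewrite /rows /= f3.2 // f2.2 // f1.2.
  (* Array 1 is still zero, which encodes the policy that always takes the action of rank 0. Zero
     values and any policy are accurate up to [H]. *)
  have /card_gt0P[a0 _] := actions_gt0 M.
  exists (fun=> enum_val (Ordinal (actions_gt0 M))); split.
    by move=> s h; rewrite enum_valK /= /update /= f3.1 // f2.1 // f1.1.
  move=> _; rewrite expn0 divr1; split=> h t hH.
    rewrite (_ : rows _ _ _ _ = 0) ?sub0r ?normrN.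
      by rewrite ger0_norm ?optimal_value_ge0 // optimal_value_le_horizon.
    by rewrite /rows /= f3.2 // f2.2 // f1.2.
  have /andP[+ _] := policy_value_bounds (fun=> enum_val (Ordinal (actions_gt0 M))) t hH.
  by have := optimal_value_le_horizon M h t; rewrite -/H; lra.
have hbody j c' : (j < K)%N -> frame (For 10 (var 5) phase) c5 c' ->
    nmem c' 10 0 = j -> I j c' ->
    wp M phase c' (phase_time M m2) (phase_calls M m2) (phase_fail M good l)
      (fun c2 => I j.+1 (setn c2 10 0 j.+1)).
  move=> jK _ _ Ij.
  have P0 : 0 < (2 ^ j)%:R :> R by rewrite ltr0n expn_gt0.
  (* By minimality of [K], the accuracy before each pass is still at least [1 / e], the level below
     which a pass no longer halves it. *)
  have u_ge : e%:R^-1 <= H%:R / (2 ^ j)%:R :> R.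
    rewrite ler_pdivlMr // mulrC ler_pdivrMr // -natrM ltW //.
    by have := K_min jK; rewrite mul1r.
  have u_le : H%:R / (2 ^ j)%:R <= H%:R :> R.
    by rewrite ler_pdivrMr // ler_peMr // ler1n expn_gt0.
  have W := wp_phase e_gt1 l_gt0 u_ge u_le (@stage_samples_ge R H l e) Ij.
  apply: wp_weaken W _ _ _ _ => // c6 f6 [env6 end6 [pi [out6 close6]]].
  have uE : H%:R / (2 ^ j.+1)%:R = H%:R / (2 ^ j)%:R / 2 :> R.
    by rewrite expnS natrM invfM mulrCA mulrC.
  by rewrite /I uE; split=> //; exists pi.
have xb : 10%N \notin nwritten phase by [].
have en c' : frame (For 10 (var 5) phase) c5 c' -> neval c' (var 5) = K.
  by move=> f; rewrite /= f.1.
exact: (wp_for (phase_fail_ge0 M good l) xb en I0 hbody).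
Qed.
End Program.

(** * Running time, sample complexity and failure probability *)

Section Bounds.
Variable R : realType.
Implicit Types x y : R.

Lemma ln2_ge_half : 2^-1 <= ln (2 : R).
Proof.
rewrite -[leLHS]expRK ler_ln ?posrE ?expR_gt0 //.
apply: le_trans (expR_le_quadratic _) _; lra.
Qed.

(** Taking logarithms gives [(k - 1) * ln 2 <= ln 2 + ln x], and [ln 2] is at least 1/2. *)
Lemma exponent_le_ln (k : nat) x : 1 <= x ->
  ((0 < k)%N -> (2 ^ k.-1)%:R < 2 * x) -> k%:R <= 2 + 2 * ln x.
Proof.
move=> x1 kx; have l0 := ln_ge0 x1; case: k kx => [|k] kx; first by lra.
have x0 : 0 < x by lra.
have : ln ((2 ^ k)%:R : R) <= ln (2 * x).
  by rewrite ler_ln ?posrE ?ltr0n ?expn_gt0 ?mulr_gt0 // ltW // kx.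
rewrite natrX lnXn // lnM ?posrE // -[_ *+ k]mulr_natr -[k.+1%:R]natr1.
have := ln2_ge_half; have : 0 <= k%:R :> R by rewrite ler0n.
set c := ln 2; set y := k%:R; move=> y0 c2 h.
have : (y - 1) * c <= ln x by lra.
case: (lerP 1 y) => y1; last by lra.
have : (y - 1) * 2^-1 <= (y - 1) * c by rewrite ler_wpM2l // subr_ge0.
lra.
Qed.

Lemma le_exponent_max (k : nat) x : k%:R <= 2 + 2 * ln x ->
  k%:R <= 4 * Num.max 1 (ln x).
Proof.
move=> kx; have : 1 <= Num.max 1 (ln x) by rewrite le_max lexx.
have : ln x <= Num.max 1 (ln x) by rewrite le_max lexx orbT.
lra.
Qed.

(** For [x >= 2] the additive 2 is at most [4 * ln x]. This serves the sample bound, whose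
    logarithms are not cut off at 1. *)
Lemma le_exponent_ln (k : nat) x : 2 <= x -> k%:R <= 2 + 2 * ln x ->
  k%:R <= 6 * ln x.
Proof.
move=> x2 kx; have := ln2_ge_half.
have : ln 2 <= ln x by rewrite ler_ln ?posrE //; lra.
lra.
Qed.

Lemma expR_opp5 (l : nat) : expR (- ell R l) <= ((2 ^ l)%:R ^+ 5)^-1.
Proof.
rewrite expRN lef_pV2 ?posrE ?expR_gt0 ?exprn_gt0 ?ltr0n ?expn_gt0 //.
have e1 : 2 <= expR (1 : R) by apply: le_trans (expR_ge1Dx _); lra.
rewrite /ell natrX -exprM mulnC.
rewrite (_ : 5 * l%:R = (5 * l)%:R * 1 :> R); last by rewrite natrM mulr1.
by rewrite expRM_natl lerXn2r ?nnegrE ?expR_ge0.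
Qed.

End Bounds.

(** The overheads of the loops are absorbed from the innermost one outwards, each product being at
    least 1. The [+ 1] keeps this true for [m = 0], which occurs at horizon 1. *)
Lemma nat_time_bound (s a h m : nat) :
  (0 < s)%N -> (0 < a)%N -> (0 < h)%N ->
  ((h + 1) * s * 3 + 2 +
   (s * (a * (h * m * 3 + 2).+2 + 2).+2 + 2 +
    (h * (s * (a * (m * 6 + h * m * 3 + 12).+2 + 2).+2 + 2).+2 + 2)) + 2
   <= 44 * (h * (s * (a * (h * m + 1)))))%N.
Proof.
move=> s0 a0 h0.
have mh : (m <= h * m)%N by rewrite leq_pmull.
set y := (h * m + 1)%N.
have y0 : (0 < y)%N by rewrite /y addn1.
have ay : (a <= a * y)%N by rewrite leq_pmulr.
have b1 : (a * (m * 6 + h * m * 3 + 12).+2 <= 14 * (a * y))%N.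
  by rewrite mulnCA leq_mul2l; apply/orP; right; rewrite /y; lia.
have b2 : (a * (h * m * 3 + 2).+2 <= 4 * (a * y))%N.
  by rewrite mulnCA leq_mul2l; apply/orP; right; rewrite /y; lia.
move: b1 b2; set z := (a * y)%N in ay *.
have z0 : (0 < z)%N by rewrite muln_gt0 a0.
move=> b1 b2.
have sz : (s <= s * z)%N by rewrite leq_pmulr.
have b3 : (s * (a * (m * 6 + h * m * 3 + 12).+2 + 2).+2 <= 18 * (s * z))%N.
  by rewrite mulnCA leq_mul2l; apply/orP; right; lia.
have b4 : (s * (a * (h * m * 3 + 2).+2 + 2).+2 <= 8 * (s * z))%N.
  by rewrite mulnCA leq_mul2l; apply/orP; right; lia.
move: b3 b4; set w := (s * z)%N in sz *.
have w0 : (0 < w)%N by rewrite muln_gt0 s0.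
move=> b3 b4.
have hw : (w <= h * w)%N by rewrite leq_pmull.
have b5 : (h * (s * (a * (m * 6 + h * m * 3 + 12).+2 + 2).+2 + 2).+2 <= 22 * (h * w))%N.
  by rewrite mulnCA leq_mul2l; apply/orP; right; lia.
have b6 : ((h + 1) * s <= 2 * (h * w))%N.
  by rewrite mulnA; apply: leq_mul => //; lia.
move: b4 b5 b6 hw; set q := (h * w)%N; lia.
Qed.

(** The passes account for [44 * cc.+1]. The doubling loops and the isolated steps cost
    [3 * (ke + l + K) + 13], whence [22 = 9 + 13]. *)
Lemma nat_total_bound (s a h m ke l K e cc pt : nat) :
  (0 < s)%N -> (0 < a)%N -> (0 < h)%N -> (0 < l)%N -> (0 < K)%N -> (0 < e)%N ->
  (ke <= e)%N -> (m <= cc * (h * h * l * (e * e)))%N ->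
  (pt.+2 <= 44 * (h * (s * (a * (h * m + 1)))))%N ->
  (ke * 3 + 3 + (l * 3 + 3 + (K * 3 + 3 + (2 + (K * pt.+2 + 2))))
   <= (44 * cc.+1 + 22) * (K * (h ^ 4 * s * a) * l * (e * e)))%N.
Proof.
move=> s0 a0 h0 l0 K0 e0 kee mb ptb.
set G := (K * _ * _ * _)%N.
pose q := (h * h * h * l * (e * e))%N.
have q0 : (0 < q)%N by rewrite !muln_gt0 h0 l0 e0.
have qb : (h * m + 1 <= cc.+1 * q)%N.
  have := leq_mul (leqnn h) mb.
  have -> : (h * (cc * (h * h * l * (e * e))) = cc * q)%N by rewrite /q; ring.
  by rewrite mulSn; lia.
have GE : G = (K * (h * (s * (a * q))))%N.
  by rewrite /G /q; ring.
have hG : (44 * cc.+1 * G = K * (44 * (h * (s * (a * (cc.+1 * q))))))%N.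
  by rewrite GE; ring.
have b1 : (K * pt.+2 <= 44 * cc.+1 * G)%N.
  rewrite hG leq_mul2l; apply/orP; right; apply: leq_trans ptb _.
  by rewrite !leq_mul2l qb !orbT.
have f0 : (0 < h * (s * a))%N by rewrite !muln_gt0 h0 s0.
have GE2 : G = (h ^ 3 * (h * (s * a)) * (K * (l * (e * e))))%N.
  by rewrite /G; ring.
have g0 : (0 < h ^ 3 * (h * (s * a)))%N by rewrite muln_gt0 expn_gt0 h0 /= f0.
have Gb : (K * (l * (e * e)) <= G)%N by rewrite GE2 leq_pmull.
have ee : (e <= e * e)%N by rewrite leq_pmull.
have ee0 : (0 < e * e)%N by rewrite muln_gt0 e0.
have KG : (K <= G)%N.
  by apply: leq_trans Gb; rewrite leq_pmulr // muln_gt0 l0.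
have lG : (l <= G)%N.
  apply: leq_trans Gb; apply: (@leq_trans (l * (e * e))); last by rewrite leq_pmull.
  by rewrite leq_pmulr.
have eG : (ke <= G)%N.
  apply: leq_trans Gb; apply: (leq_trans kee); apply: (leq_trans ee).
  by rewrite mulnA leq_pmull // muln_gt0 K0.
by rewrite mulnDl; lia.
Qed.

Lemma stage_samples_le H l e :
  (stage_samples H l e <= 128 * 128 * (H * H * l * (e * e)))%N.
Proof.
rewrite /stage_samples; set cc := (128 * 128)%N.
have -> : (cc * (H - 1) * H * l * e * e = cc * ((H - 1) * H * l * (e * e)))%N by ring.
by rewrite leq_mul2l !leq_mul ?orbT // leq_subr.
Qed.

(** * Cost and failure probability in terms of [eps] and [delta] *)

Section Main.
Variables (R : realType) (S A : finType) (M : mdp R S A) (eps delta : R).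
Hypotheses (eps01 : 0 < eps < 1) (delta01 : 0 < delta < 1).
Let H : nat := horizon M.
Let X : R := H%:R * #|S|%:R * #|A|%:R / (delta * eps).
Let Y : R := H%:R / eps.

Let eps0 : 0 < eps. Proof. by case/andP: eps01. Qed.
Let eps1 : eps < 1. Proof. by case/andP: eps01. Qed.
Let delta0 : 0 < delta. Proof. by case/andP: delta01. Qed.
Let delta1 : delta < 1. Proof. by case/andP: delta01. Qed.

Let H1 : 1 <= H%:R :> R. Proof. by rewrite ler1n horizon_gt0. Qed.
Let S1 : 1 <= #|S|%:R :> R. Proof. by rewrite ler1n (states_gt0 M). Qed.
Let A1 : 1 <= #|A|%:R :> R. Proof. by rewrite ler1n (actions_gt0 M). Qed.

Lemma ratio_ge_horizon : H%:R <= Y.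
Proof. by rewrite ler_pdivlMr // ler_piMr ?ler0n // ltW. Qed.

Lemma ratio_ge_size : H%:R <= X.
Proof.
have de0 : 0 < delta * eps by rewrite mulr_gt0.
have de1 : delta * eps <= 1.
  by have := ler_pM (ltW delta0) (ltW eps0) (ltW delta1) (ltW eps1); rewrite mulr1.
rewrite ler_pdivlMr //.
have h : H%:R <= H%:R * #|S|%:R :> R by rewrite ler_peMr.
have h2 : H%:R * #|S|%:R <= H%:R * #|S|%:R * #|A|%:R :> R.
  by rewrite ler_peMr // mulr_ge0.
apply: le_trans (le_trans h h2).
by rewrite ler_piMr.
Qed.

Variables (ke l K : nat).
Let e := (2 ^ ke)%N.
Hypotheses (ke_le : 1 <= eps * e%:R)
  (ke_min : forall j, (j < ke)%N -> eps * (2 ^ j)%:R < 1).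
Hypotheses (l_le : (H * #|S| * #|A| * e)%:R <= delta * (2 ^ l)%:R)
  (l_min : forall j, (j < l)%N -> delta * (2 ^ j)%:R < (H * #|S| * #|A| * e)%:R).
Hypotheses (K_le : (H * e)%:R <= 1 * (2 ^ K)%:R :> R)
  (K_min : forall j, (j < K)%N -> 1 * (2 ^ j)%:R < (H * e)%:R :> R).

Lemma accuracy_exponent_gt0 : (0 < ke)%N.
Proof.
rewrite lt0n; apply: contraTneq ke_le => k0.
by rewrite /e k0 expn0 mulr1 -ltNge.
Qed.

Let e2 : (2 <= e)%N.
Proof. by rewrite /e -{1}(expn1 2) leq_exp2l // accuracy_exponent_gt0. Qed.

Lemma log_exponent_gt0 : (0 < l)%N.
Proof.
rewrite lt0n; apply: contraTneq l_le => ->; rewrite expn0 mulr1 -ltNge.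
apply: (lt_le_trans delta1); rewrite ler1n !muln_gt0 horizon_gt0 (states_gt0 M).
by rewrite (actions_gt0 M) ltnW.
Qed.

Lemma phases_gt0 : (0 < K)%N.
Proof.
rewrite lt0n; apply: contraTneq K_le => ->; rewrite expn0 mulr1 -ltNge ltr1n.
by apply: (leq_trans e2); rewrite leq_pmull // horizon_gt0.
Qed.

Let e_lt : e%:R < 2 / eps.
Proof.
rewrite ltr_pdivlMr // mulrC.
have := ke_min (_ : ke.-1 < ke)%N; rewrite prednK ?accuracy_exponent_gt0 // leqnn.
move=> /(_ isT) h; rewrite /e -(prednK accuracy_exponent_gt0) expnS natrM.
by rewrite mulrCA; lra.
Qed.

Lemma log_exponent_le : l%:R <= 2 + 2 * ln X.
Proof.
apply: exponent_le_ln => [|l0]; first by apply: le_trans ratio_ge_size.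
have lt_l : (l.-1 < l)%N by rewrite prednK.
rewrite -(ltr_pM2l delta0); apply: lt_le_trans (l_min lt_l) _.
have -> : delta * (2 * X) = H%:R * #|S|%:R * #|A|%:R * (2 / eps).
  by rewrite /X; field; rewrite !gt_eqF.
by rewrite !natrM ler_wpM2l ?mulr_ge0 // ltW.
Qed.

Lemma phases_le : K%:R <= 2 + 2 * ln Y.
Proof.
apply: exponent_le_ln => [|K0]; first by apply: le_trans ratio_ge_horizon.
have lt_K : (K.-1 < K)%N by rewrite prednK.
have := K_min lt_K; rewrite mul1r => /lt_le_trans; apply.
rewrite natrM (_ : 2 * Y = H%:R * (2 / eps)); last by rewrite /Y; ring.
by rewrite ler_wpM2l // ltW.
Qed.

Let cc : nat := (128 * 128)%N.
(** The first factor comes from [nat_total_bound]; [64] is [4 * 4 * 4], the price of replacing [K],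
    [l] and [e * e] by the two logarithms and [1 / eps^2]. *)
Definition cost_constant : R := (44 * (128 * 128).+1 + 22)%:R * 64.

Let e_sqr : (e * e)%:R <= 4 * (eps ^+ 2)^-1 :> R.
Proof.
have -> : 4 * (eps ^+ 2)^-1 = (2 / eps) * (2 / eps) :> R.
  by field; rewrite gt_eqF.
by rewrite natrM ler_pM // ltW.
Qed.

Lemma program_time_le : (program_time M ke l K)%:R <=
  cost_constant * ((eps ^+ 2)^-1 * (H%:R ^+ 4 * #|S|%:R * #|A|%:R)
    * Num.max 1 (ln X) * Num.max 1 (ln Y)).
Proof.
have T : (program_time M ke l K <=
    (44 * cc.+1 + 22) * (K * (H ^ 4 * #|S| * #|A|) * l * (e * e)))%N.
  apply: (nat_total_bound (m := stage_samples H l e)); rewrite ?(states_gt0 M) ?(actions_gt0 M)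
    ?horizon_gt0 ?log_exponent_gt0 ?phases_gt0 ?(ltnW e2) //.
  - by rewrite ltnW // ltn_expl.
  - exact: stage_samples_le.
  rewrite -addn2; apply: nat_time_bound; rewrite ?(states_gt0 M) ?(actions_gt0 M)
    ?horizon_gt0 //.
apply: (@le_trans _ _ ((44 * cc.+1 + 22) * (K * (H ^ 4 * #|S| * #|A|) * l * (e * e)))%N%:R).
  by rewrite ler_nat.
rewrite natrM /cost_constant -/cc -[leRHS]mulrA ler_wpM2l ?ler0n //.
set h4 := H%:R ^+ 4 * _ * _.
rewrite (_ : (K * (H ^ 4 * #|S| * #|A|) * l * (e * e))%:R
    = K%:R * h4 * l%:R * (e * e)%:R); last first.
  rewrite (natrM _ (K * (H ^ 4 * #|S| * #|A|) * l)) /h4 -natrX -!natrM.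
  by rewrite -!mulnA.
have h40 : 0 <= h4 by rewrite !mulr_ge0 ?exprn_ge0.
have -> : 64 * ((eps ^+ 2)^-1 * h4 * Num.max 1 (ln X) * Num.max 1 (ln Y)) =
  (4 * Num.max 1 (ln Y)) * h4 * (4 * Num.max 1 (ln X)) * (4 * (eps ^+ 2)^-1).
  by ring.
apply: ler_pM => //; first by rewrite ?mulr_ge0.
apply: ler_pM => //; first by rewrite ?mulr_ge0.
  by rewrite ler_wpM2r // le_exponent_max // phases_le.
exact: le_exponent_max log_exponent_le.
Qed.

Let m2 := stage_samples H l e.

Lemma phase_calls_le : (K * phase_calls M m2)%:R <=
  cost_constant * ((eps ^+ 2)^-1 * (H%:R ^+ 3 * #|S|%:R * #|A|%:R) * ln X * ln Y).
Proof.
have lX0 : 0 <= ln X by rewrite ln_ge0 // (le_trans H1 ratio_ge_size).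
have lY0 : 0 <= ln Y by rewrite ln_ge0 // (le_trans H1 ratio_ge_horizon).
have c0 : 0 <= cost_constant by rewrite mulr_ge0.
have ei : 0 <= (eps ^+ 2)^-1 by rewrite invr_ge0 exprn_ge0 // ltW.
(* At horizon 1 both logarithms of the bound need not be bounded away from 0, but no oracle call is
   made. Otherwise both ratios are at least 2, and [K], [l], [e * e] cost the factor
   [6 * 6 * 4 = 144]. *)
have [Hle1|H2] := leqP H 1.
  rewrite (_ : phase_calls _ _ = 0%N) ?muln0; first by rewrite !mulr_ge0 ?exprn_ge0.
  have HE : (H - 1 = 0)%N by apply/eqP; rewrite subn_eq0.
  by rewrite /phase_calls /m2 /stage_samples HE muln0 !mul0n !muln0.
have HR2 : 2 <= H%:R :> R by rewrite ler_nat.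
have Kb : K%:R <= 6 * ln Y.
  by apply: le_exponent_ln phases_le; apply: le_trans ratio_ge_horizon.
have lb : l%:R <= 6 * ln X.
  by apply: le_exponent_ln log_exponent_le; apply: le_trans ratio_ge_size.
have N : (K * phase_calls M m2 <=
    2 * cc * (K * (H ^ 3 * #|S| * #|A|) * l * (e * e)))%N.
  have mb : (m2 <= cc * (H * H * l * (e * e)))%N := stage_samples_le H l e.
  rewrite /phase_calls -/H.
  have -> : (K * (#|S| * (#|A| * (H * m2)) + H * (#|S| * (#|A| * m2))) =
     2 * K * H * #|S| * #|A| * m2)%N by ring.
  have -> : (2 * cc * (K * (H ^ 3 * #|S| * #|A|) * l * (e * e)) =
     2 * K * H * #|S| * #|A| * (cc * (H * H * l * (e * e))))%N by ring.
  by rewrite leq_mul2l mb orbT.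
apply: (@le_trans _ _ (2 * cc * (K * (H ^ 3 * #|S| * #|A|) * l * (e * e)))%N%:R).
  by rewrite ler_nat.
set h3 := H%:R ^+ 3 * _ * _.
have h30 : 0 <= h3 by rewrite !mulr_ge0 ?exprn_ge0.
have cb : (2 * cc)%:R * 144 <= cost_constant.
  rewrite /cost_constant -/cc natrD (natrM _ 2 cc) (natrM _ 44 cc.+1).
  rewrite -[cc.+1%:R]natr1; set x : R := cc%:R.
  have : 0 <= x by rewrite ler0n.
  move: x => x; lra.
apply: le_trans (_ : (2 * cc)%:R * 144
  * ((eps ^+ 2)^-1 * h3 * ln X * ln Y) <= _); last first.
  by rewrite ler_wpM2r // !mulr_ge0.
rewrite natrM -[leRHS]mulrA ler_wpM2l ?ler0n //.
rewrite (_ : (K * (H ^ 3 * #|S| * #|A|) * l * (e * e))%:R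
    = K%:R * h3 * l%:R * (e * e)%:R); last first.
  rewrite (natrM _ (K * (H ^ 3 * #|S| * #|A|) * l)) /h3 -natrX -!natrM.
  by rewrite -!mulnA.
have -> : 144 * ((eps ^+ 2)^-1 * h3 * ln X * ln Y) =
  (6 * ln Y) * h3 * (6 * ln X) * (4 * (eps ^+ 2)^-1) by ring.
apply: ler_pM => //; first by rewrite ?mulr_ge0.
apply: ler_pM => //; first by rewrite ?mulr_ge0.
by rewrite ler_wpM2r.
Qed.

(** The failures add up to [4 * expR (- ell) * K * s]. Since [K <= H * e], the product [K * s] is at
    most [Q ^+ 2], and [Q <= delta * P]. The factor [P ^- 5] from [expR_opp5] leaves
    [delta * (4 / P ^+ 3)], where [P >= 2]. *)
Lemma total_fail_le : K%:R * phase_fail M true l <= delta.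
Proof.
set P : R := (2 ^ l)%:R.
have P2 : 2 <= P.
  by rewrite /P ler_nat -{1}(expn1 2) leq_exp2l // log_exponent_gt0.
have P0 : 0 < P by lra.
have KHe : K%:R <= (H * e)%:R :> R.
  have lt_K : (K.-1 < K)%N by rewrite prednK // phases_gt0.
  have := K_min lt_K; rewrite mul1r => /ltW; apply: le_trans; rewrite ler_nat.
  by have := ltn_expl K.-1 (isT : (1 < 2)%N); rewrite prednK // phases_gt0.
set Q : R := (H * #|S| * #|A| * e)%:R.
have Ql : Q <= delta * P := l_le.
have eR : 1 <= e%:R :> R by rewrite ler1n ltnW.
set s : R := H%:R * #|S|%:R * #|A|%:R.
have s0 : 0 <= s by rewrite !mulr_ge0.
have QE : Q = s * e%:R by rewrite /Q !natrM.
have Ks : K%:R * s <= Q * Q.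
  apply: (@le_trans _ _ ((H * e)%:R * s)); first by rewrite ler_wpM2r.
  rewrite QE natrM; apply: ler_pM; rewrite ?mulr_ge0 //.
    rewrite ler_wpM2r // /s -mulrA ler_peMr // -[leLHS]mulr1.
    by rewrite ler_pM.
  by rewrite ler_peMr.
have ub : K%:R * phase_fail M true l = 4 * expR (- ell R l) * (K%:R * s).
  by rewrite /phase_fail /fail1 /fail2 /s -/H; ring.
rewrite ub.
have Q0 : 0 <= Q by rewrite ler0n.
have QP : Q * Q <= (delta * P) * (delta * P) by rewrite ler_pM.
have x5 := expR_opp5 R l; rewrite -/P in x5.
have h1 : K%:R * s <= delta * P ^+ 2.
  apply: (le_trans Ks); apply: (le_trans QP).
  have -> : delta * P * (delta * P) = delta * (delta * P ^+ 2) by ring.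
  by rewrite ler_wpM2l ?(ltW delta0) // ler_piMl ?exprn_ge0 // ltW.
apply: (@le_trans _ _ (4 * (P ^+ 5)^-1 * (delta * P ^+ 2))).
  apply: ler_pM => //; first by rewrite mulr_ge0 ?expR_ge0.
  - by rewrite mulr_ge0.
  - by rewrite ler_wpM2l.
have -> : 4 * (P ^+ 5)^-1 * (delta * P ^+ 2) = delta * (4 / P ^+ 3).
  by field; rewrite gt_eqF.
rewrite ler_piMr ?(ltW delta0) // ler_pdivrMr ?exprn_gt0 // mul1r.
have : 4 <= P ^+ 2 by rewrite expr2; have := ler_pM _ _ P2 P2; lra.
rewrite exprS => P4; have := ler_pM _ _ P2 P4; lra.
Qed.

Lemma final_accuracy : H%:R / (2 ^ K)%:R <= eps.
Proof.
have P0 : 0 < (2 ^ K)%:R :> R by rewrite ltr0n expn_gt0.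
rewrite ler_pdivrMr //; move: K_le; rewrite mul1r natrM => h.
have := ler_wpM2l (ltW eps0) h; apply: le_trans.
by rewrite mulrCA ler_peMr.
Qed.

Lemma halt_prob_program (good : bool) (E : config R -> Prop) :
  (forall c, phase_invariant M m2 good (H%:R / (2 ^ K)%:R) c ->
     (calls c <= K * phase_calls M m2)%N -> E (load [::] c)) ->
  1 - K%:R * phase_fail M good l
    <= halt_prob M E (program_time M ke l K) (start M program eps delta).
Proof.
move=> QE.
have W := wp_program ke_le ke_min l_le l_min K_le K_min
  accuracy_exponent_gt0 log_exponent_gt0 (good := good).
have := W [::] E 0%N 1 (lexx _); rewrite cats0 add0n; apply.
move=> c _ cD Qc; rewrite halt_prob_halted //.
by case: asboolP => // -[]; exact: QE.
Qed.

End Main.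

(* The constant C is universal and the program is uniform: it gets the state
   and action counts, the horizon, the rewards, eps and delta as input, and
   learns about the transitions only through the oracle.  In the running time,
   each logarithm is replaced by 1 when it is smaller than 1: as H = 1 and
   eps, delta -> 1, the product of the logarithms tends to 0, while every
   algorithm that outputs a policy takes at least one step.  If H >= 2 or
   eps <= 1/2, this affects the bound by a constant factor only. *)
Theorem theoremF5 (R : realType) :
  exists (prog : seq instr) (C : R), 0 < C /\
  forall (S A : finType) (M : mdp R S A) (eps delta : R),
    0 < eps < 1 -> 0 < delta < 1 ->
    let H : R := (horizon M)%:R in
    let nS : R := #|S|%:R in
    let nA : R := #|A|%:R in
    exists time samples : nat,
    [/\ time%:R <= C * ((eps ^+ 2)^-1 * (H ^+ 4 * nS * nA)
                        * Num.max 1 (ln (H * nS * nA / (delta * eps)))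
                        * Num.max 1 (ln (H / eps))),
        samples%:R <= C * ((eps ^+ 2)^-1 * (H ^+ 3 * nS * nA)
                           * ln (H * nS * nA / (delta * eps))
                           * ln (H / eps)),
        halt_prob M (fun c => (calls c <= samples)%N /\
                              exists pi : policy M, outputs c pi)
                  time (start M prog eps delta) = 1
      & 1 - delta <=
        halt_prob M (fun c => exists2 pi : policy M, outputs c pi &
                       forall (h : 'I_(horizon M)) (s : S),
                         optimal_value M h s - eps <= policy_value pi h s
                         <= optimal_value M h s)
                  time (start M prog eps delta)].
Proof.
exists program, (cost_constant R); split.
  by rewrite /cost_constant mulr_gt0 // ltr0n addn_gt0 orbT.
move=> S A M eps delta eps01 delta01 H n_S n_A.
have eps0 : 0 < eps by case/andP: eps01.
have delta0 : 0 < delta by case/andP: delta01.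
have [ke [ke_le ke_min]] := doubling_count 1 eps0.
have [l [l_le l_min]] :=
  doubling_count (horizon M * #|S| * #|A| * 2 ^ ke)%:R delta0.
have [K [K_le K_min]] := doubling_count (horizon M * 2 ^ ke)%:R (ltr01 : 0 < 1 :> R).
exists (program_time M ke l K).
exists (K * phase_calls M (stage_samples (horizon M) l (2 ^ ke)))%N; split.
- by apply: program_time_le.
- by apply: phase_calls_le.
- apply/eqP; rewrite eq_le halt_prob_le1 /=.
  (* With [good] false all failure probabilities are 0, so the same specification yields a statement
     of probability 1. *)
  have -> : 1 = 1 - K%:R * phase_fail M false l :> R.
    by rewrite /phase_fail /fail1 /fail2 !mulr0 addr0 mulr0 subr0.
  apply: halt_prob_program => // c [_ _ [pi [out _]]] cD.
  by split=> //; exists pi.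
apply: (@le_trans _ _ (1 - K%:R * phase_fail M true l)).
  by rewrite lerD2l lerN2; apply: (@total_fail_le R S A M eps delta _ _ ke).
apply: halt_prob_program => // c [_ _ [pi [out /(_ isT)[_ close]]]] _.
exists pi => // i s; have iH : (i <= horizon M)%N by exact: ltnW.
have /andP[_ ->] := policy_value_bounds pi s iH; rewrite andbT.
apply: le_trans (close i s iH); rewrite lerD2l lerN2.
exact: (final_accuracy eps01 ke_le K_le).
Qed.
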